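(* Let $\{x_t\}$ be generated by the variance-reduced stochastic projected gradient (VR-SPG) method described in the context with epoch length $T$, large batch size $N$, and assume $k\ge T$. Set $\gamma_t=\gamma\ge4\bar{\mathcal L}$, $\gamma>0$, for all $t$ and the batch sizes (for $2\le u\le T$) $$b_{s,u}:=\begin{cases}\lceil T^2/(u-1)\rceil,&s=1,\\\lceil 13T/2\rceil,&s\ge2.\end{cases}$$ Let the output $x_{R(k)}$ be chosen randomly (independently of the samples) from $\{x_0,\dots,x_{k-1}\}$ with $\mathbb P(x_{R(k)}=x_{t-1})=t\big(\sum_{j=1}^kj\big)^{-1}$, $t=1,\dots,k$. Then $$\mathbb E\big[\|g_{X,R(k)}\|^2\big]\le\Big(\sum_{t=1}^k\tfrac{t}{8\gamma}\Big)^{-1}\Big[\tfrac{lk}{2}D_X^2+\tfrac{3\gamma}{2}D_X^2+\tfrac{21(k+1)k\sigma^2}{8\gamma N}\Big].$$ Specifically, if $\gamma=4\bar{\mathcal L}$, then $$\mathbb E\big[\|g_{X,R(k)}\|^2\big]\le\frac{32\,\bar{\mathcal L}\,l\,D_X^2}{k+1}+\frac{384\,\bar{\mathcal L}^2D_X^2}{k(k+1)}+\frac{42\sigma^2}{N}.$$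
   Context: $\|\cdot\|$, $\langle\cdot,\cdot\rangle$ are Euclidean. $X\subseteq\mathbb R^n$ is a nonempty convex compact set with diameter $D_X=\max_{x,y\in X}\|x-y\|$; $f:X\to\mathbb R$ is continuously differentiable with $\|\nabla f(x)-\nabla f(y)\|\le L\|x-y\|$ for all $x,y\in X$ (hence $f(x)-f(y)-\langle\nabla f(y),x-y\rangle\le\tfrac L2\|x-y\|^2$), and, for some $l\in[0,L]$, $f(x)-f(y)-\langle\nabla f(y),x-y\rangle\ge-\tfrac l2\|x-y\|^2$ for all $x,y\in X$. Stochastic oracle: given $x\in X$ it returns $\mathcal F(x,\xi)$ and $\mathcal G(x,\xi)=\nabla\mathcal F(x,\xi)$, $\xi\in\Xi$ random; all samples are i.i.d. Assumptions, for all $x,y\in X$: $\mathbb E_\xi[\mathcal F(x,\xi)]=f(x)$, $\mathbb E_\xi[\mathcal G(x,\xi)]=\nabla f(x)$; $\mathbb E_\xi\|\mathcal G(x,\xi)-\nabla f(x)\|^2\le\sigma^2$ with $\sigma^2>0$; for each $\xi$ there is $\mathcal L(\xi)\ge0$ with $\|\mathcal G(x,\xi)-\mathcal G(y,\xi)\|\le\mathcal L(\xi)\|x-y\|$ and $\mathcal F(x,\xi)-\mathcal F(y,\xi)-\langle\mathcal G(y,\xi),x-y\rangle\le\tfrac{\mathcal L(\xi)}2\|x-y\|^2$, where $\mathcal L(\xi)\le\hat{\mathcal L}$ almost surely and $\mathbb E[\mathcal L(\xi)^2]\le\bar{\mathcal L}^2$. Write $L\le\bar{\mathcal L}$ for the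 smoothness constant of $f$. Indexing: for epoch index $s\ge1$ and $1\le u\le T$, iteration $t=(s-1)T+u$ is also indexed $(s,u)$, e.g. $x_t=x_{s,u}$, $b_t=b_{s,u}$; $x_{s,0}=x_{s-1,T}$, $x_{1,0}=x_0$. VR-SPG method: given $x_0\in X$, for $t=1,\dots,k$: if $t$ is the first iteration of an epoch ($u=1$, i.e. $\mathrm{mod}(t,T)=1$), draw fresh i.i.d. samples $\xi^t_1,\dots,\xi^t_N$ and set $\tilde G_t=\tfrac1N\sum_{i=1}^N\mathcal G(x_{t-1},\xi^t_i)$; otherwise draw fresh i.i.d. samples $\xi^t_1,\dots,\xi^t_{b_t}$ and set $\tilde G_t=\tfrac1{b_t}\sum_{i=1}^{b_t}[\mathcal G(x_{t-1},\xi^t_i)-\mathcal G(x_{t-2},\xi^t_i)]+\tilde G_{t-1}$. Then $x_t=\arg\min_{x\in X}\{\langle\tilde G_t,x\rangle+\tfrac{\gamma_t}2\|x_{t-1}-x\|^2\}$. Projected gradient: $P_X(x,g,\gamma):=\gamma(x-x^+)$, $x^+=\arg\min_{u\in X}\{\langle g,u\rangle+\tfrac\gamma2\|x-u\|^2\}$; $g_{X,t}:=P_X(x_t,\nabla f(x_t),\gamma_{t+1})$. *)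

(* Defs.v *)
From HB Require Import structures.
From mathcomp Require Import all_boot all_order all_algebra.
From mathcomp Require Import all_classical all_reals all_analysis.

Set Implicit Arguments.
Unset Strict Implicit.
Unset Printing Implicit Defensive.

Import Order.TTheory GRing.Theory Num.Theory.
Import numFieldNormedType.Exports.

Local Open Scope classical_set_scope.
Local Open Scope ring_scope.

(* The library norm `|v| on 'rV[R]_n is the sup norm, whence [enorm]. *)
Definition dotv (R : realType) (n : nat) (u v : 'rV[R]_n) : R :=
  \sum_(i < n) u 0 i * v 0 i.

Definition enorm (R : realType) (n : nat) (u : 'rV[R]_n) : R :=
  Num.sqrt (dotv u u).

(* Meant for nonempty compact X, where the supremum is a maximum. *)
Definition diameter (R : realType) (n : nat) (X : set 'rV[R]_n) : R :=
  sup [set enorm (p.1 - p.2) | p in X `*` X].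

(* [g] is a gradient at x of the function f defined on X: first-order expansion
   along the points of X.  X may have empty interior, in which case g need not
   be unique. *)
Definition is_gradient_on (R : realType) (n : nat) (X : set 'rV[R]_n)
    (f : 'rV[R]_n -> R) (x g : 'rV[R]_n) : Prop :=
  forall e : R, 0 < e ->
    \forall y \near within X (nbhs x),
      `|f y - f x - dotv g (y - x)| <= e * enorm (y - x).

Definition C1_on (R : realType) (n : nat) (X : set 'rV[R]_n)
    (f : 'rV[R]_n -> R) (gradf : 'rV[R]_n -> 'rV[R]_n) : Prop :=
  (forall x, X x -> is_gradient_on X f x (gradf x)) /\
  {within X, continuous gradf}.

(* Some minimizer of h over X, and 0 if there is none.  In the uses below X is
   nonempty, convex and compact, and h is continuous and strongly convex. *)
Definition argmin (R : realType) (n : nat) (X : set 'rV[R]_n)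
    (h : 'rV[R]_n -> R) : 'rV[R]_n :=
  xget 0 [set u | X u /\ forall v, X v -> h u <= h v].

Definition prox_step (R : realType) (n : nat) (X : set 'rV[R]_n)
    (x g : 'rV[R]_n) (gamma : R) : 'rV[R]_n :=
  argmin X (fun u => dotv g u + gamma / 2 * enorm (x - u) ^+ 2).

Definition proj_grad (R : realType) (n : nat) (X : set 'rV[R]_n)
    (x g : 'rV[R]_n) (gamma : R) : 'rV[R]_n :=
  gamma *: (x - prox_step X x g gamma).

(* Expectations of vectors are taken coordinatewise.  Only measurability in the
   random argument, at each fixed point of X, is required of F and G. *)
Record stochastic_oracle (R : realType) (n : nat) (X : set 'rV[R]_n)
    (f : 'rV[R]_n -> R) (gradf : 'rV[R]_n -> 'rV[R]_n)
    (d : measure_display) (Xi : measurableType d) (mu : probability Xi R)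
    (F : 'rV[R]_n -> Xi -> R) (G : 'rV[R]_n -> Xi -> 'rV[R]_n)
    (Lip : Xi -> R) (Lhat Lbar sigma : R) : Prop := {
  oracle_value_integrable : forall x, X x ->
    mu.-integrable [set: Xi] (EFin \o F x);
  oracle_grad_integrable : forall x i, X x ->
    mu.-integrable [set: Xi] (fun z => (G x z 0 i)%:E);
  oracle_value_mean : forall x, X x -> ('E_mu [F x] = (f x)%:E)%E;
  oracle_grad_mean : forall x i, X x ->
    ('E_mu [fun z => G x z 0%R i] = (gradf x 0%R i)%:E)%E;
  oracle_variance : forall x, X x ->
    ('E_mu [fun z => (enorm (G x z - gradf x) ^+ 2)%R] <= (sigma ^+ 2)%:E)%E;
  oracle_gradient : forall x z, X x -> is_gradient_on X (F ^~ z) x (G x z);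
  oracle_Lip_ge0 : forall z, 0 <= Lip z;
  oracle_Lip_measurable : measurable_fun [set: Xi] Lip;
  oracle_lipschitz : forall x y z, X x -> X y ->
    enorm (G x z - G y z) <= Lip z * enorm (x - y);
  oracle_upper_curvature : forall x y z, X x -> X y ->
    F x z - F y z - dotv (G y z) (x - y) <= Lip z / 2 * enorm (x - y) ^+ 2;
  oracle_Lip_bounded : {ae mu, forall z, Lip z <= Lhat};
  oracle_Lip_moment : ('E_mu [fun z => (Lip z ^+ 2)%R] <= (Lbar ^+ 2)%:E)%E }.

(* For t >= 1, t = (s - 1) T + u with s = epoch T t and u = epoch_pos T t in
   1, ..., T. *)
Definition epoch (T t : nat) : nat := (t.-1 %/ T).+1.
Definition epoch_pos (T t : nat) : nat := (t.-1 %% T).+1.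

(* Irrelevant at the first iteration of an epoch. *)
Definition small_batch (T t : nat) : nat :=
  if epoch T t == 1%N then
    `|Num.ceil ((T ^ 2)%:R / (epoch_pos T t).-1%:R : rat)|%N
  else `|Num.ceil ((13 * T)%:R / 2 : rat)|%N.

Definition nb_samples (T N : nat) (b : nat -> nat) (t : nat) : nat :=
  if epoch_pos T t == 1%N then N else b t.

(* xi t i, with i counted from 0, is the sample i + 1 of iteration t, and
   Gt t is the gradient estimator of iteration t. *)
Record VR_SPG (R : realType) (n : nat) (X : set 'rV[R]_n)
    (Xi Omega : Type) (G : 'rV[R]_n -> Xi -> 'rV[R]_n)
    (x0 : 'rV[R]_n) (T N k : nat) (b : nat -> nat) (gamma : nat -> R)
    (xi : nat -> nat -> Omega -> Xi) (x Gt : nat -> Omega -> 'rV[R]_n)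
    : Prop := {
  VR_SPG_init : forall w, x 0 w = x0;
  VR_SPG_restart : forall t w, (1 <= t <= k)%N -> epoch_pos T t = 1%N ->
    Gt t w = N%:R^-1 *: \sum_(i < N) G (x t.-1 w) (xi t i w);
  VR_SPG_recursion : forall t w, (1 <= t <= k)%N -> epoch_pos T t <> 1%N ->
    Gt t w = (b t)%:R^-1 *:
      \sum_(i < b t) (G (x t.-1 w) (xi t i w) - G (x t.-2 w) (xi t i w))
      + Gt t.-1 w;
  VR_SPG_step : forall t w, (1 <= t <= k)%N ->
    x t w = prox_step X (x t.-1 w) (Gt t w) (gamma t) }.

Definition g_X (R : realType) (n : nat) (X : set 'rV[R]_n)
    (gradf : 'rV[R]_n -> 'rV[R]_n) (gamma : nat -> R) (Omega : Type)
    (x : nat -> Omega -> 'rV[R]_n) (t : nat) (w : Omega) : 'rV[R]_n :=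
  proj_grad X (x t w) (gradf (x t w)) (gamma t.+1).

Definition mutually_independent (d : measure_display) (Omega : measurableType d)
    (R : realType) (P : probability Omega R) (I : eqType) (D : set I)
    (S : I -> set (set Omega)) : Prop :=
  forall (J : seq I) (A : I -> set Omega),
    uniq J -> (forall j, j \in J -> D j) -> (forall j, j \in J -> S j (A j)) ->
    P (\bigcap_(j in [set` J]) A j) = (\prod_(j <- J) P (A j))%E.

(* The sigma-algebra of the sample (t, i) at index Some (t, i), and that of the
   output index at None: mutual independence of this family says that the
   samples are mutually independent and the output index is independent of
   them. *)
Definition draws (d d' : measure_display) (Omega : measurableType d)
    (Xi : measurableType d') (xi : nat -> nat -> Omega -> Xi)
    (rk : Omega -> nat) (j : option (nat * nat)) : set (set Omega) :=
  match j with
  | Some (t, i) => preimage_set_system [set: Omega] (xi t i) measurable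
  | None => preimage_set_system [set: Omega] rk measurable
  end.

(* Only the draws made during the k iterations are constrained. *)
Definition used_draws (m : nat -> nat) (k : nat) : set (option (nat * nat)) :=
  [set j | match j with
           | Some (t, i) => (1 <= t <= k)%N /\ (i < m t)%N
           | None => True
           end].

(* Main.v *)
Require Import Defs.
From HB Require Import structures.
From mathcomp Require Import all_boot all_order all_algebra.
From mathcomp Require Import all_classical all_reals all_analysis.
From mathcomp Require Import measurable_realfun.
From mathcomp Require Import ring lra zify.

Set Implicit Arguments.
Unset Strict Implicit.
Unset Printing Implicit Defensive.

Import Order.TTheory GRing.Theory Num.Theory.
Import numFieldNormedType.Exports.

Local Open Scope classical_set_scope.
Local Open Scope ring_scope.

(** Let delta_t = G~_t - grad f(x_(t-1)) be the error of the gradient estimator,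
    u a minimizer of f over X and D_X the diameter of X.

    Every run satisfies two inequalities at each iteration: a descent inequality
    between f(x_t) and f(x_(t-1)), and a gap inequality between f(x_t) and f(u)
    in which the squared distances to u telescope and the nonconvexity costs
    only (l/2) D_X^2 ([step_descent], [step_gap]). Adding t - 1 times the former
    to the latter makes t (f(x_t) - f(u)) telescope, so that the sum over t of
    (7t/8 - 1/2) gamma |x_t - x_(t-1)|^2 is at most (gamma/2 + lk/2) D_X^2 plus
    the sum of the noise terms t <delta_t, x_(t-1) - x_t> and <delta_t, u -
    x_(t-1)> ([run_bound]). Since |g_(X,t-1)|^2 is at most 2 gamma^2 |x_t -
    x_(t-1)|^2 + 2 |delta_t|^2, this controls the gradient mappings with weights
    t/(8 gamma), and only the noise remains.

    The estimator is biased given the past, but inside an epoch delta_t is a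
    martingale. Hence q_t = E<delta_t, u - x_(t-1)> vanishes at the first
    iteration of an epoch, and later q_t = q_(t-1) + E<delta_(t-1), x_(t-2) -
    x_(t-1)>. Summed over an epoch that ends at iteration E, the two noise terms
    together give E<delta_t, x_(t-1) - x_t> the coefficient E instead of t. From
    the second epoch on, E <= 2t, and Young's inequality absorbs this into the
    descent. In the first epoch E = T may be much larger than t; there q_t is
    bounded by gamma D_X^2 / T + T/(4 gamma) E|delta_t|^2 instead, and these T
    bounds turn gamma/2 into 3 gamma/2. In both cases E|delta_t|^2 starts an
    epoch below sigma^2/N and increases by at most Lbar^2/b_t E|x_(t-1) -
    x_(t-2)|^2; the batch sizes are such that these increases are absorbed too
    ([total_loss_bound]).

    The martingale property and the variance recursion rest on the
    independence of each draw from the sigma-algebra of all earlier ones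
    ([independent_of_group]): the law of the pair (past, draw) is a product
    measure, and the draw can be integrated first ([ge0_integral_fresh],
    [batch_moments]). This needs the iterates to be measurable for the past,
    and the oracle, evaluated at an iterate, to be jointly measurable in the
    past and the draw; both follow from continuity in the point after
    composition with the projection onto X ([measurable_fun_caratheodory],
    [measurable_lipschitz_on]). *)

(** * Error budget of the epochs *)

Lemma epochE (T s u : nat) : (u < T)%N -> epoch T (s * T + u.+1) = s.+1.
Proof.
by move=> uT; rewrite /epoch addnS/= divnMDl ?(leq_ltn_trans _ uT)// divn_small
  ?addn0.
Qed.

Lemma epoch_posE (T s u : nat) : (u < T)%N -> epoch_pos T (s * T + u.+1) = u.+1.
Proof. by move=> uT; rewrite /epoch_pos addnS/= modnMDl modn_small. Qed.

(** In the application W t = gamma E|x_t - x_(t-1)|^2, D t = E|delta_t|^2 /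
    gamma, p t = E<delta_t, x_(t-1) - x_t>, q t = E<delta_t, u - x_(t-1)>, C
    = gamma D_X^2 and S = sigma^2 / (gamma N). *)
Section recursion.
Context (R : realFieldType) (T k : nat) (b : nat -> nat) (C S : R).
Variables (W D p q : nat -> R).
Hypotheses (T_gt0 : (0 < T)%N) (T_le_k : (T <= k)%N).
Hypotheses (C_ge0 : 0 <= C) (S_ge0 : 0 <= S).
Hypothesis W_ge0 : forall t, 0 <= W t.
Hypothesis D_ge0 : forall t, 0 <= D t.
Hypothesis restart : forall t, (1 <= t <= k)%N -> epoch_pos T t = 1%N ->
  q t = 0 /\ D t <= S.
Hypothesis recursion : forall t, (1 <= t <= k)%N -> epoch_pos T t <> 1%N ->
  q t = q t.-1 + p t.-1 /\ D t <= D t.-1 + W t.-1 / (16 * (b t)%:R).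
Hypothesis b_first : forall t, (1 <= t)%N -> epoch_pos T t <> 1%N ->
  epoch T t = 1%N -> (T ^ 2 <= b t * (epoch_pos T t).-1)%N.
Hypothesis b_later : forall t, (1 <= t)%N -> epoch_pos T t <> 1%N ->
  epoch T t <> 1%N -> (13 * T <= 2 * b t)%N.
Hypothesis p_le : forall t (c : R), (1 <= t <= k)%N -> 0 < c ->
  p t <= c / 2 * W t + D t / (2 * c).
Hypothesis q_le : forall t, (1 <= t <= k)%N -> q t <= C / T%:R + T%:R / 4 * D t.

(** The gradient bound t/4 (W + D) and the noise t p + q, minus the descent
    (7t/8 - 1/2) W. *)
Definition loss (t : nat) : R :=
  t%:R * D t / 4 - (5 / 8 * t%:R - 1 / 2) * W t + t%:R * p t + q t.

Definition total_loss (t : nat) : R := \sum_(1 <= j < t.+1) loss j.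

Lemma total_lossS t : total_loss t.+1 = total_loss t + loss t.+1.
Proof. by rewrite /total_loss big_nat_recr. Qed.

(** The sum of 5j/4 + T/4 over t < j <= T. *)
Let first_weight (t : R) : R :=
  5 / 8 * (T%:R * (T%:R + 1) - t * (t + 1)) + T%:R * (T%:R - t) / 4.

(** Iteration 1 costs (17/4) D 1, and iteration j >= 2 of the first epoch
    costs (5j/4 + T/4) D j. Each such D j contains D t and, through the
    variance recursion, a multiple of W t for every t < j: the second summand
    reserves what the iterations after t will charge for them. *)
Lemma first_epoch_invariant j : (j < T)%N ->
  total_loss j.+1 +
    first_weight j.+1%:R * (D j.+1 + j.+1%:R * W j.+1 / (16 * T%:R ^+ 2))
  <= j.+1%:R / T%:R * C + (17 / 4 + first_weight 1) * S.
Proof.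
have T1 : (1 : R) <= T%:R by rewrite ler1n.
have T0 : 0 < T%:R :> R by rewrite (lt_le_trans ltr01).
have TT : 0 < (T%:R : R) ^+ 2 by rewrite exprn_gt0.
have D_first t : (0 < t < T)%N -> D t.+1 <= D t + t%:R * W t / (16 * T%:R ^+ 2).
  move=> tT; have tT' : (t < T)%N by case/andP: tT.
  have tk : (1 <= t.+1 <= k)%N by rewrite /= (leq_trans tT').
  have pt : epoch_pos T t.+1 = t.+1 by exact: (@epoch_posE T 0 t).
  have et : epoch T t.+1 = 1%N by exact: (@epochE T 0 t).
  have pt1 : epoch_pos T t.+1 <> 1%N by rewrite pt; lia.
  have [_ Dt] := recursion tk pt1; rewrite -pred_Sn in Dt.
  have := b_first (ltn0Sn t) pt1 et; rewrite pt -(ler_nat R) natrM natrX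
    -pred_Sn => bt.
  have b_gt0 : 0 < (b t.+1)%:R :> R.
    rewrite ltr0n lt0n; apply/eqP => b0; move: bt; rewrite b0 mul0r; apply/negP.
    by rewrite -ltNge.
  apply: (le_trans Dt); rewrite lerD2l.
  rewrite ler_pdivrMr ?mulr_gt0// mulrAC ler_pdivlMr ?mulr_gt0//.
  by have := ler_wpM2l (W_ge0 t) bt; lra.
elim: j => [|j IH] jT.
  have [tk p1] : (1 <= 1 <= k)%N /\ epoch_pos T 1 = 1%N.
    by split; [lia|exact: (@epoch_posE T 0 0)].
  have [q1 D1] := restart tk p1.
  have pl : p 1 <= W 1 / 16 + 4 * D 1.
    (* only W 1 / 8 of the descent is available at the first iteration *)
    have c0 : 0 < 1 / 8 :> R by lra.
    by have := p_le tk c0; lra.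
  rewrite total_lossS /total_loss big_geq// add0r /loss q1.
  have c1 : first_weight 1 <= T%:R ^+ 2 by rewrite /first_weight; nra.
  have c0 : 0 <= first_weight 1 by rewrite /first_weight; nra.
  have W1 : first_weight 1 * (1%:R * W 1 / (16 * T%:R ^+ 2)) <= W 1 / 16.
    rewrite mulrA ler_pdivrMr ?mulr_gt0//.
    by have := ler_wpM2r (W_ge0 1) c1; lra.
  have DS := ler_wpM2l c0 D1.
  have CT : 0 <= 1%:R / T%:R * C by rewrite mulr_ge0 ?divr_ge0 ?ler0n.
  by rewrite mulrDr; lra.
have jT' : (0 < j.+1 < T)%N by [].
have tk : (1 <= j.+2 <= k)%N by rewrite /= (leq_trans jT).
have pl : p j.+2 <= W j.+2 / 4 + D j.+2.
  have c0 : 0 < 1 / 2 :> R by lra.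
  by have := p_le tk c0; lra.
have ql := q_le tk.
have Dl := D_first _ jT'.
have W0 := W_ge0 j.+2; have D0 := D_ge0 j.+2.
rewrite total_lossS /loss.
have {}IH := IH (ltnW jT).
have tau1 : 1 <= j.+1%:R :> R by rewrite ler1n.
have tauT : j.+1%:R + 1 <= T%:R :> R by rewrite natr1 ler_nat.
have -> : j.+2%:R = j.+1%:R + 1 :> R by rewrite natr1.
move: tau1 tauT IH Dl; set t : R := j.+1%:R.
set x := t * W _ / _ => t1 tT IH Dl.
have w0 : 0 <= first_weight t by rewrite /first_weight; nra.
have w1 : first_weight (t + 1) <= T%:R ^+ 2 by rewrite /first_weight; nra.
have w01 : first_weight t = first_weight (t + 1) + (5 / 4 * (t + 1) + T%:R / 4).
  by rewrite /first_weight; field.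
have W1 : first_weight (t + 1) * ((t + 1) * W j.+2 / (16 * T%:R ^+ 2))
    <= (t + 1) * W j.+2 / 16.
  rewrite mulrA ler_pdivrMr ?mulr_gt0//.
  have tW0 : 0 <= (t + 1) * W j.+2 by rewrite mulr_ge0//; lra.
  by have := ler_wpM2r tW0 w1; lra.
have wD := ler_wpM2l w0 Dl.
have tp : (t + 1) * p j.+2 <= (t + 1) * (W j.+2 / 4 + D j.+2).
  by rewrite ler_wpM2l//; lra.
have tW : W j.+2 <= t * W j.+2 by nra.
have wDE : first_weight t * D j.+2 = first_weight (t + 1) * D j.+2 +
    (5 / 4 * (t + 1) + T%:R / 4) * D j.+2 by rewrite w01; ring.
by lra.
Qed.

Lemma first_epoch_loss : total_loss T <= C + 21 / 8 * (T%:R * (T%:R + 1)) * S.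
Proof.
have := @first_epoch_invariant T.-1.
rewrite prednK// leqnn => /(_ isT).
have -> : first_weight T%:R = 0 by rewrite /first_weight; ring.
rewrite mul0r addr0 divff ?pnatr_eq0 -?lt0n// mul1r => H.
apply: (le_trans H); rewrite lerD2l ler_wpM2r// /first_weight.
have T1 : (1 : R) <= T%:R by rewrite ler1n.
by nra.
Qed.

(** In an epoch that ends at E, each of the E - t iterations after t repeats
    q t + p t in its own q, which is why the coefficient of p becomes E in
    the end; each also charges (5/4) E for the variance that it inherits from
    iteration t. The division by 104 T is 16 b with b = 13 T / 2. *)
Lemma later_epoch_invariant s r j :
  (0 < s)%N -> (r <= T)%N -> (s * T + r <= k)%N -> (j < r)%N ->
  let E : R := (s * T + r)%:R in let t := (s * T + j.+1)%N in
  total_loss t + (E - t%:R) * (q t + p t)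
    + (E - t%:R) * (5 / 4 * E) * (D t + W t / (104 * T%:R))
  <= total_loss (s * T) + r%:R * (5 / 4 * E) * S.
Proof.
move=> s0 rT Ek; have T1 : (1 : R) <= T%:R by rewrite ler1n.
have T104 : 0 < 104 * T%:R :> R by lra.
have D_later u : (u.+1 < r)%N ->
    D (s * T + u.+2) <= D (s * T + u.+1) + W (s * T + u.+1) / (104 * T%:R)
    /\ q (s * T + u.+2) = q (s * T + u.+1) + p (s * T + u.+1).
  move=> ur; have tk : (1 <= s * T + u.+2 <= k)%N by lia.
  have uT : (u.+1 < T)%N by rewrite (leq_trans ur).
  have pt : epoch_pos T (s * T + u.+2) <> 1%N by rewrite epoch_posE.
  have et : epoch T (s * T + u.+2) <> 1%N by rewrite epochE//; lia.
  have [qt Dt] := recursion tk pt; rewrite addnS -pred_Sn -addnS in qt Dt.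
  split=> //; apply: (le_trans Dt); rewrite lerD2l.
  have t0 : (0 < s * T + u.+2)%N by lia.
  have := b_later t0 pt et; rewrite -(ler_nat R) !natrM => bt.
  have W0 := W_ge0 (s * T + u.+1).
  by rewrite ler_wpM2l// lef_pV2 ?posrE; lra.
have p_later t : (1 <= t <= k)%N -> p t <= W t / 4 + D t.
  move=> tk; have c0 : 0 < 1 / 2 :> R by lra.
  by have := p_le tk c0; lra.
(* an epoch other than the first starts no earlier than its own length *)
have E_le : (s * T + r)%:R <= 2 * (s * T)%:R :> R.
  by rewrite -natrM ler_nat; nia.
elim: j => [|j IH] jr /=; set E : R := (s * T + r)%:R.
  set t := (s * T + 1)%N.
  have tk : (1 <= t <= k)%N by rewrite /t; lia.
  have pt : epoch_pos T t = 1%N by apply: epoch_posE; lia.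
  have [q1 D1] := restart tk pt.
  have pl := p_later t tk.
  rewrite {1}/t addn1 total_lossS -addn1 -/t /loss q1.
  have Et : E = r%:R + (s * T)%:R by rewrite /E natrD addrC.
  have tE : t%:R = (s * T)%:R + 1 :> R by rewrite /t addn1 -natr1.
  have tau0 : 1 <= (s * T)%:R :> R by rewrite ler1n; lia.
  have r1 : 1 <= r%:R :> R by rewrite ler1n.
  have rT' : r%:R <= T%:R :> R by rewrite ler_nat.
  rewrite tE; move: E_le tau0; rewrite -/E; set tau : R := (s * T)%:R => E_le
    tau1.
  have W0 := W_ge0 t; have D0 := D_ge0 t.
  have Ep : E * p t <= E * (W t / 4 + D t) by rewrite ler_wpM2l// Et; lra.
  have W1 : (E - (tau + 1)) * (5 / 4 * E) * (W t / (104 * T%:R)) <= 5 / 4 * E *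
    W t / 104.
    rewrite mulrA ler_pdivrMr//.
    have EW : 0 <= E * W t by rewrite mulr_ge0// Et; lra.
    have : (E - (tau + 1)) * (E * W t) <= T%:R * (E * W t)
      by rewrite ler_wpM2r// Et; lra.
    by lra.
  have EWt : E * W t <= 2 * tau * W t by rewrite ler_wpM2r.
  have rD : r%:R * (5 / 4 * E) * D t <= r%:R * (5 / 4 * E) * S.
    by rewrite ler_wpM2l// mulr_ge0 ?ler0n// Et; lra.
  have ED : tau * D t <= E * D t - D t.
    have : (tau + 1) * D t <= E * D t by rewrite ler_wpM2r// Et; lra.
    by lra.
  have rE : r%:R = E - tau by rewrite Et; ring.
  have tW : W t <= tau * W t by rewrite ler_peMl.
  by rewrite rE in rD *; lra.
set t := (s * T + j.+2)%N.
have [Dl ql] := D_later _ jr.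
have {}IH := IH (ltnW jr); rewrite /= in IH.
have tk : (1 <= t <= k)%N by rewrite /t; lia.
have pl := p_later t tk.
have tE : t = (s * T + j.+1).+1 by rewrite /t addnS.
apply: le_trans IH; rewrite -/E.
rewrite {1}tE total_lossS -tE -lerBlDl /loss.
move: Dl ql; rewrite -/t.
have -> : t%:R = (s * T + j.+1)%:R + 1 :> R by rewrite tE natr1.
have tauE : (s * T + j.+1)%:R + 1 <= E by rewrite natr1 ler_nat; lia.
have tau1 : 1 <= (s * T + j.+1)%:R :> R by rewrite ler1n; lia.
have tauT : E <= (s * T + j.+1)%:R + T%:R by rewrite -natrD ler_nat; lia.
have tau2 : E <= 2 * (s * T + j.+1)%:R by rewrite -natrM ler_nat; nia.
set u := (s * T + j.+1)%N in tauE tau1 tauT tau2 *.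
move: tauE tau1 tauT tau2; set tau : R := u%:R => tauE tau1 tauT tau2 Dl ql.
have W0 := W_ge0 t; have D0 := D_ge0 t.
have E0 : 0 <= E by lra.
have Ep : E * p t <= E * (W t / 4 + D t) by rewrite ler_wpM2l.
have W1 : (E - (tau + 1)) * (5 / 4 * E) * (W t / (104 * T%:R)) <= 5 / 4 * E * W
  t / 104.
  rewrite mulrA ler_pdivrMr//.
  have EW : 0 <= E * W t by rewrite mulr_ge0.
  have : (E - (tau + 1)) * (E * W t) <= T%:R * (E * W t) by rewrite ler_wpM2r//;
    lra.
  by lra.
have EWt : E * W t <= 2 * tau * W t by rewrite ler_wpM2r.
have ED : tau * D t <= E * D t - D t.
  have : (tau + 1) * D t <= E * D t by rewrite ler_wpM2r.
  by lra.
have tW : W t <= tau * W t by rewrite ler_peMl.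
have c0 : 0 <= (E - tau) * (5 / 4 * E) by rewrite mulr_ge0; lra.
have DD := ler_wpM2l c0 Dl.
by rewrite ql; lra.
Qed.

(** The E - t iterations cost (5/4) E S each, hence at most the increase of
    (21/8) E (E + 1) S over the epoch. *)
Lemma later_epoch_loss s r : (0 < s)%N -> (r <= T)%N -> (s * T + r <= k)%N ->
  let E : R := (s * T + r)%:R in let t : R := (s * T)%:R in
  total_loss (s * T + r) <= total_loss (s * T)
    + 21 / 8 * (E * (E + 1) - t * (t + 1)) * S.
Proof.
move=> s0 rT; case: r rT => [|r] rT Ek /=; set E : R := (_ + _)%:R;
  set t : R := (s * T)%:R.
  by rewrite /E /t addn0 subrr mulr0 mul0r addr0.
have := @later_epoch_invariant s r.+1 r s0 rT Ek (ltnSn r).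
rewrite /= subrr !mul0r !addr0 => H; apply: (le_trans H).
rewrite lerD2l ler_wpM2r//.
have -> : r.+1%:R = E - t by rewrite /E natrD /t; ring.
have tE : t <= E by rewrite ler_nat; lia.
have t0 : 0 <= t by exact: ler0n.
have -> : E * (E + 1) - t * (t + 1) = (E - t) * (E + t + 1) by ring.
have : (E - t) * (5 / 4 * E) <= (E - t) * (21 / 8 * (E + t + 1)).
  by rewrite ler_wpM2l//; lra.
by lra.
Qed.

Lemma total_loss_bound :
  total_loss k <= C + 21 / 8 * (k%:R * (k%:R + 1)) * S.
Proof.
have epochs s : (0 < s)%N -> (s * T <= k)%N ->
    total_loss (s * T) <= C + 21 / 8 * ((s * T)%:R * ((s * T)%:R + 1)) * S.
  elim: s => // -[_ _ _|s IH _ sTk]; first by rewrite mul1n;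
    exact: first_epoch_loss.
  have /(_ isT) := IH; rewrite -/(is_true _) => IH'.
  have sT : (s.+1 * T <= k)%N by apply: leq_trans sTk; rewrite leq_mul2r leqnSn
    orbT.
  have := @later_epoch_loss s.+1 T isT (leqnn _).
  rewrite -mulSnr => /(_ sTk) /= H.
  by move: (IH' sT) H; lra.
have k_eq := divn_eq k T.
have s_gt0 : (0 < k %/ T)%N by rewrite divn_gt0.
have := @later_epoch_loss (k %/ T) (k %% T) s_gt0 (ltnW (ltn_pmod _ T_gt0)).
rewrite -k_eq => /(_ (leqnn _)) /= H.
have := epochs _ s_gt0 (leq_divM _ _).
by move: H; lra.
Qed.
End recursion.

(** * Euclidean geometry and prox steps *)

Section euclid.
Context (R : realType) (n : nat).
Implicit Types (u v w : 'rV[R]_n) (a c : R).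

Lemma dotvC u v : dotv u v = dotv v u.
Proof. by apply: eq_bigr => i _; rewrite mulrC. Qed.

Lemma dotvDl u v w : dotv (u + v) w = dotv u w + dotv v w.
Proof. by rewrite -big_split; apply: eq_bigr => i _; rewrite mxE mulrDl. Qed.

Lemma dotvZl a u v : dotv (a *: u) v = a * dotv u v.
Proof. by rewrite mulr_sumr; apply: eq_bigr => i _; rewrite mxE mulrA. Qed.

Lemma dotvNl u v : dotv (- u) v = - dotv u v.
Proof. by rewrite -scaleN1r dotvZl mulN1r. Qed.

Lemma dotvDr u v w : dotv u (v + w) = dotv u v + dotv u w.
Proof. by rewrite !(dotvC u) dotvDl. Qed.

Lemma dotvZr a u v : dotv u (a *: v) = a * dotv u v.
Proof. by rewrite !(dotvC u) dotvZl. Qed.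

Lemma dotvNr u v : dotv u (- v) = - dotv u v.
Proof. by rewrite !(dotvC u) dotvNl. Qed.

Lemma dotv0l u : dotv 0 u = 0.
Proof. by rewrite -(scale0r 0) dotvZl mul0r. Qed.

Definition dotvE := (dotvDl, dotvDr, dotvNl, dotvNr, dotvZl, dotvZr).

Lemma dotvv_ge0 u : 0 <= dotv u u.
Proof. by apply: sumr_ge0 => i _; rewrite -expr2 sqr_ge0. Qed.

Lemma enorm_ge0 u : 0 <= enorm u. Proof. exact: sqrtr_ge0. Qed.

Lemma enorm_sqr u : enorm u ^+ 2 = dotv u u.
Proof. by rewrite sqr_sqrtr ?dotvv_ge0. Qed.

Lemma dotvv_eq0 u : dotv u u = 0 -> u = 0.
Proof.
move/eqP; rewrite psumr_eq0 => [/allP u0|i _]; last by rewrite -expr2 sqr_ge0.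
apply/rowP => i; rewrite mxE; apply/eqP.
by have := u0 i (mem_index_enum _); rewrite -expr2 sqrf_eq0.
Qed.

Lemma coord_le_enorm u i : `|u 0 i| <= enorm u.
Proof.
rewrite -sqrtr_sqr ler_wsqrtr// /dotv (bigD1 i)//= -expr2 lerDl.
by apply: sumr_ge0 => j _; rewrite -expr2 sqr_ge0.
Qed.

Lemma coord_le_norm u i : `|u 0 i| <= `|u|.
Proof. by rewrite [leRHS]/Num.Def.normr /= mx_normrE;
  apply: (le_bigmax _ (fun ij => `|u ij.1 ij.2|) (0, i)). Qed.

Lemma enorm_le_norm u : enorm u <= Num.sqrt n%:R * `|u|.
Proof.
rewrite -(@ler_pXn2r _ 2) ?nnegrE ?mulr_ge0 ?enorm_ge0 ?sqrtr_ge0//.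
rewrite enorm_sqr exprMn sqr_sqrtr ?ler0n// mulr_natl.
have -> : `|u| ^+ 2 *+ n = \sum_(i < n) `|u| ^+ 2 by rewrite sumr_const
  card_ord.
apply: ler_sum => i _.
by rewrite -expr2 -real_normK ?num_real// lerXn2r ?nnegrE ?coord_le_norm.
Qed.

(** The weighted arithmetic-geometric inequality for inner products. *)
Lemma dotv_young c u v : 0 < c ->
  dotv u v <= c / 2 * dotv v v + dotv u u / (2 * c).
Proof.
move=> c0; have := dotvv_ge0 (u - c *: v); rewrite !dotvE (dotvC v u) => H.
rewrite -(ler_pM2l (_ : 0 < 2 * c)) ?mulr_gt0// mulrDr.
rewrite [2 * c * (_ / (2 * c))]mulrC divfK ?mulf_neq0 ?gt_eqF//.
by nra.
Qed.

(** The topology is that of the sup norm, to which the Euclidean norm is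
    equivalent. *)
Lemma lipschitz_continuous (h : 'rV[R]_n -> R) K :
  (forall u v, `|h u - h v| <= K * enorm (u - v)) -> continuous h.
Proof.
move=> hK u; have FF : Filter (nbhs u) by exact: nbhs_filter.
apply/(@cvgrPdist_lt _ _ _ (nbhs u)) => e e0.
pose C := `|K| * Num.sqrt n%:R + 1.
have C0 : 0 < C by rewrite ltr_pwDr// mulr_ge0 ?sqrtr_ge0.
apply/nbhs_ballP; exists (e / C) => [|v]; first by rewrite /= divr_gt0.
rewrite -ball_normE /= ltr_pdivlMr// mulrC => uv.
apply: (le_lt_trans (hK u v)); apply: (@le_lt_trans _ _ (C * `|u - v|)).
  apply: (@le_trans _ _ (`|K| * enorm (u - v))).
    by rewrite ler_wpM2r ?enorm_ge0 ?ler_norm.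
  apply: (@le_trans _ _ (`|K| * (Num.sqrt n%:R * `|u - v|))).
    by rewrite ler_wpM2l ?enorm_le_norm.
  by rewrite mulrA ler_wpM2r// /C lerDl.
exact: uv.
Qed.

Lemma continuous_dotv (g h : 'rV[R]_n -> 'rV[R]_n) :
  continuous g -> continuous h -> continuous (fun u => dotv (g u) (h u)).
Proof.
move=> cg ch; apply: (@continuous_big _ _ (fun x y : R => x + y)).
  by move=> x; apply: cvgD; [exact: cvg_fst|exact: cvg_snd].
move=> i _ u; have FF : Filter (nbhs u) by exact: nbhs_filter.
apply: (@cvgM _ _ (nbhs u)).
  exact: (@continuous_comp _ _ _ g (fun M : 'rV[R]_n => M 0 i) u (cg u)
    (@coord_continuous R _ _ 0 i (g u))).
exact: (@continuous_comp _ _ _ h (fun M : 'rV[R]_n => M 0 i) u (ch u)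
  (@coord_continuous R _ _ 0 i (h u))).
Qed.

End euclid.

Section compact_convex.
Context (R : realType) (n : nat) (X : set 'rV[R]_n).
Hypotheses (X_nonempty : X !=set0) (X_convex : convex_set X).
Hypothesis X_compact : compact X.
Implicit Types (u v p g x : 'rV[R]_n).

Lemma diameter_ub u v : X u -> X v -> dotv (u - v) (u - v) <= diameter X ^+ 2.
Proof.
move=> Xu Xv; have le_diam : enorm (u - v) <= diameter X.
  apply: ub_le_sup; last by exists (u, v).
  have [M XM] := ex_strict_bound_gt0 (compact_bounded X_compact).
  move=> XM'; exists (Num.sqrt n%:R * (M + M)) => _ [[a b] [/= Xa Xb] <-].
  apply: (le_trans (enorm_le_norm _)); rewrite ler_wpM2l ?sqrtr_ge0//.
  apply: (le_trans (ler_normB _ _)).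
  by rewrite lerD// ltW// XM'.
by rewrite -enorm_sqr lerXn2r ?nnegrE ?(le_trans _ le_diam) ?enorm_ge0.
Qed.

(** First-order optimality. Along the segment from p to v the objective is a
    quadratic polynomial in the step, minimal at 0, so its slope at 0 is
    nonnegative. *)
Lemma prox_stepP x g gamma : 0 < gamma ->
  let p := prox_step X x g gamma in
  X p /\ forall v, X v -> 0 <= dotv (g - gamma *: (x - p)) (v - p).
Proof.
move=> g0 p; pose h u := dotv g u + gamma / 2 * enorm (x - u) ^+ 2.
have [Xp hp] : X p /\ forall v, X v -> h p <= h v.
  have hc : continuous h.
    move=> u; have FF : Filter (nbhs u) by exact: nbhs_filter.
    apply: (@cvgD _ _ _ (nbhs u)).
      exact: (@continuous_dotv _ _ (fun=> g) id (@cst_continuous _ _ g)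
        (fun w => @cvg_id _ (nbhs w))).
    apply: (@cvgM _ _ (nbhs u)); first exact: cvg_cst.
    under eq_fun do rewrite enorm_sqr; rewrite enorm_sqr.
    have cx : continuous (fun w : 'rV[R]_n => x - w : 'rV[R]_n).
      move=> w; have Fw : Filter (nbhs w) by exact: nbhs_filter.
      by apply: (@cvgB _ _ _ (nbhs w)); [exact: cvg_cst|exact: cvg_id].
    exact: (@continuous_dotv _ _ _ _ cx cx u).
  have [c cX hcmin] := EVT_min_rV X_nonempty X_compact
    (continuous_subspaceT hc).
  rewrite /p /prox_step /argmin; case: xgetP => [u _ //|/(_ c)].
  by case; split; [exact/set_mem|move=> v Xv; apply: hcmin; exact/mem_set].
split=> // v Xv; set A := dotv _ _.
rewrite leNgt; apply/negP => A0.
have small s : 0 < s -> s <= 1 -> 0 <= A + s * (gamma / 2 * dotv (v - p)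
  (v - p)).
  move=> s0 s1; have Xz : X (p + s *: (v - p)).
    have := X_convex (Itv01 (ltW s0) s1) (mem_set Xv) (mem_set Xp).
    rewrite inE; congr (X _); rewrite /conv/=.
    by rewrite scalerBr scalerBl scale1r addrCA.
  have := hp _ Xz; rewrite /h !enorm_sqr.
  rewrite -(pmulr_rge0 _ s0) /A !dotvE (dotvC v p) (dotvC x p) (dotvC x v).
  by lra.
(* a step for which the quadratic term cannot make up for a negative slope *)
pose Q := gamma / 2 * dotv (v - p) (v - p).
have Q0 : 0 <= Q by rewrite mulr_ge0 ?dotvv_ge0// divr_ge0 ?ltW.
pose s := - A / (- A + Q + Q + 1).
have den : 0 < - A + Q + Q + 1 by lra.
have s0 : 0 < s by rewrite divr_gt0//; lra.
have s1 : s <= 1 by rewrite ler_pdivrMr//; lra.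
have := small s s0 s1; rewrite -/Q.
have sE : s * (- A + Q + Q + 1) = - A by rewrite divfK ?gt_eqF.
by nra.
Qed.

(** The two optimality conditions, each tested at the other point, add up to
    the firm nonexpansiveness of the projection. *)
Lemma prox_step_dist x g x' g' gamma : 0 < gamma ->
  let p := prox_step X x g gamma in let p' := prox_step X x' g' gamma in
  let y := (gamma *: x - g) - (gamma *: x' - g') in
  gamma ^+ 2 * dotv (p - p') (p - p') <= dotv y y.
Proof.
move=> g0 /=; set p := prox_step X x g gamma; set p' := prox_step X x' g' gamma.
set y := _ - (_ - _).
have [Xp vp] := prox_stepP x g g0; have [Xp' vp'] := prox_stepP x' g' g0.
rewrite -/p -/p' in Xp vp Xp' vp'.
have H1 := vp _ Xp'; have H2 := vp' _ Xp; clearbody p p'.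
have H3 : gamma * dotv (p - p') (p - p') <= dotv y (p - p').
  move: H1 H2; rewrite /y !dotvE !(dotvC _ p) !(dotvC _ p').
  by lra.
have := dotv_young y (p - p') g0; set a := dotv y y in H3 *.
set c := dotv (p - p') (p - p') in H3 *; set d := dotv y (p - p') in H3 *.
move=> H4; have {H4 H3} : gamma * c <= a / gamma.
  by move: H4; rewrite invfM mulrA; lra.
by rewrite ler_pdivlMr// expr2; lra.
Qed.

(** A prox step depends on x and g only through gamma x - g: it is the
    projection onto X of that vector divided by gamma. *)
Lemma prox_step_shift x g gamma : 0 < gamma ->
  prox_step X x g gamma = prox_step X 0 (- (gamma *: x - g)) gamma.
Proof.
move=> g0; apply/eqP; rewrite -subr_eq0; apply/eqP/dotvv_eq0/eqP.
have := prox_step_dist x g 0 (- (gamma *: x - g)) g0.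
rewrite /= scaler0 sub0r opprK subrr dotv0l => H.
by rewrite eq_le dotvv_ge0 andbT -(ler_pM2l (exprn_gt0 2 g0)) mulr0.
Qed.

Lemma prox_step_lipschitz gamma y y' : 0 < gamma ->
  enorm (prox_step X 0 (- y) gamma - prox_step X 0 (- y') gamma)
  <= gamma^-1 * enorm (y - y').
Proof.
move=> g0; rewrite mulrC ler_pdivlMr// mulrC.
rewrite -(@ler_pXn2r _ 2) ?nnegrE ?mulr_ge0 ?enorm_ge0 ?(ltW g0)// exprMn
  !enorm_sqr.
have := prox_step_dist 0 (- y) 0 (- y') g0.
by rewrite /= scaler0 !sub0r !opprK.
Qed.

Section one_run.
(* gamma / 8 is L / 2 for a smoothness constant L = gamma / 4 *)
Variables (f : 'rV[R]_n -> R) (gradf : 'rV[R]_n -> 'rV[R]_n) (l gamma : R).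
Hypotheses (l_ge0 : 0 <= l) (gamma_gt0 : 0 < gamma).
Hypothesis lower_curvature : forall u v, X u -> X v ->
  - (l / 2) * enorm (u - v) ^+ 2 <= f u - f v - dotv (gradf v) (u - v).
Hypothesis upper_curvature : forall u v, X u -> X v ->
  f u - f v - dotv (gradf v) (u - v) <= gamma / 8 * enorm (u - v) ^+ 2.

Let D2 := diameter X ^+ 2.

(** Optimality of the prox step tested at its starting point. *)
Lemma step_descent x g : X x -> let p := prox_step X x g gamma in
  f p - f x <= - (7 / 8 * gamma) * dotv (p - x) (p - x)
    - dotv (g - gradf x) (p - x).
Proof.
move=> Xx /=; set p := prox_step _ _ _ _.
have [Xp vp] := prox_stepP x g gamma_gt0; rewrite -/p in Xp vp.
have := vp _ Xx; have := upper_curvature Xp Xx; rewrite enorm_sqr.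
rewrite !dotvE !(dotvC _ p) !(dotvC _ x) (dotvC x p).
by lra.
Qed.

(** Optimality of the prox step tested at u, the inner product being expanded
    into the three squared distances; the lower curvature enters only through
    the pair (u, x). *)
Lemma step_gap x g u : X x -> X u -> let p := prox_step X x g gamma in
  f p - f u <= gamma / 2 * (dotv (x - u) (x - u) - dotv (p - u) (p - u))
    + l / 2 * D2 - 3 / 8 * gamma * dotv (p - x) (p - x)
    - dotv (g - gradf x) (p - u).
Proof.
move=> Xx Xu /=; set p := prox_step _ _ _ _.
have [Xp vp] := prox_stepP x g gamma_gt0; rewrite -/p in Xp vp.
have lD : l / 2 * dotv (u - x) (u - x) <= l / 2 * D2.
  by rewrite ler_wpM2l ?diameter_ub// divr_ge0.
have := vp _ Xu; have := upper_curvature Xp Xx; have := lower_curvature Xu Xx.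
rewrite !enorm_sqr; move: lD.
rewrite !dotvE !(dotvC _ p) !(dotvC _ x) (dotvC x p) !(dotvC _ u) (dotvC u p)
  (dotvC u x).
by lra.
Qed.

(** (t - 1) times the descent inequality plus the gap inequality bounds t
    (f(x_t) - f(u)) - (t - 1) (f(x_(t-1)) - f(u)). The sum telescopes to k
    (f(x_k) - f(u)), which is nonnegative. *)
Lemma run_bound (x g : nat -> 'rV[R]_n) u k : X (x 0%N) -> X u ->
  (forall v, X v -> f u <= f v) ->
  (forall t, (1 <= t <= k)%N -> x t = prox_step X (x t.-1) (g t) gamma) ->
  let d t := g t - gradf (x t.-1) in
  \sum_(1 <= t < k.+1)
    ((7 / 8 * t%:R - 1 / 2) * (gamma * dotv (x t - x t.-1) (x t - x t.-1))
     - t%:R * dotv (d t) (x t.-1 - x t) - dotv (d t) (u - x t.-1))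
  <= gamma / 2 * D2 + l * k%:R / 2 * D2.
Proof.
move=> X0 Xu fu xE /=; set S := \sum_(1 <= t < k.+1) _.
suff [Xk H] : X (x k) /\
    S <= gamma / 2 * (dotv (x 0%N - u) (x 0%N - u) - dotv (x k - u) (x k - u))
      + l * k%:R / 2 * D2 - k%:R * (f (x k) - f u).
  have := ler_wpM2l (ltW gamma_gt0) (diameter_ub X0 Xu).
  have := mulr_ge0 (ltW gamma_gt0) (dotvv_ge0 (x k - u)).
  have fk : 0 <= f (x k) - f u by rewrite subr_ge0 fu.
  have := mulr_ge0 (ler0n R k) fk; rewrite -/D2.
  by lra.
rewrite {}/S; elim: k xE => [|k IH] xE.
  by rewrite big_geq// subrr mulr0 mul0r mulr0 !mul0r subr0 addr0.
have [t tk|Xk H] := IH; first by apply: xE;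
  rewrite (andP tk).1 (leq_trans (andP tk).2).
have xS : x k.+1 = prox_step X (x k) (g k.+1) gamma by apply: xE;
  rewrite /= leqnn.
have [XS _] := prox_stepP (x k) (g k.+1) gamma_gt0; rewrite -xS in XS.
split=> //; rewrite big_nat_recr//=.
have dsc := step_descent (g k.+1) Xk; have gap := step_gap (g k.+1) Xk Xu.
rewrite /= -xS in dsc gap.
have {}dsc := ler_wpM2l (ler0n R k) dsc.
set d := g k.+1 - gradf (x k) in dsc gap *.
have -> : dotv d (x k - x k.+1) = - dotv d (x k.+1 - x k) by rewrite -dotvNr
  opprB.
have -> : dotv d (u - x k) = - dotv d (x k.+1 - u) + dotv d (x k.+1 - x k).
  by rewrite -dotvNr -dotvDr opprB addrA subrK.
rewrite -(natr1 k); move: H dsc gap.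
set a0 := dotv (x 0%N - u) _; set a1 := dotv (x k - u) _.
set a2 := dotv (x k.+1 - u) _; set v := dotv (x k.+1 - x k) _.
set e1 := dotv d (x k.+1 - x k); set e2 := dotv d (x k.+1 - u).
set S := \sum_(_ <= _ < _) _.
by lra.
Qed.
End one_run.
End compact_convex.

(** * Measurability of integrands of Caratheodory type *)

Section caratheodory.
Context (R : realType) (n : nat).
Context d (T : measurableType d) d' (Z : measurableType d').

Definition measurable_rV (y : T -> 'rV[R]_n) : Prop :=
  forall i, measurable_fun [set: T] (fun w => y w 0 i).

Lemma measurable_countable_glue (I : countType) (s : T -> I) (h : I -> T -> R) :
  (forall i, measurable [set w | s w = i]) ->
  (forall i, measurable_fun [set: T] (h i)) ->
  measurable_fun [set: T] (fun w => h (s w) w).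
Proof.
move=> ms mh _ B mB; rewrite setTI.
have -> : (fun w => h (s w) w) @^-1` B = \bigcup_k
    (if unpickle k is Some i then [set w | s w = i] `&` h i @^-1` B else set0).
  apply/seteqP; split=> [w Bw|w [k _]].
    by exists (pickle (s w)) => //; rewrite pickleK.
  by case: (unpickle k) => // i [/= <-].
apply: bigcupT_measurable => k; case: (unpickle k) => [i|];
  last exact: measurable0.
by apply: measurableI => //; rewrite -[X in measurable X]setTI; exact: mh.
Qed.

Let grid (m : nat) (v : 'rV[R]_n) : 'rV[int]_n :=
  \row_i Num.floor (m.+1%:R * v 0 i).
Let grid_point (m : nat) (q : 'rV[int]_n) : 'rV[R]_n :=
  \row_i ((q 0 i)%:~R / m.+1%:R).

Let grid_dist m v : `|v - grid_point m (grid m v)| <= m.+1%:R^-1.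
Proof.
rewrite [leLHS]/Num.Def.normr /= mx_normrE.
apply: bigmax_le => [|[i j] _]; first by rewrite invr_ge0.
rewrite /= ord1 !mxE.
have m0 : 0 < m.+1%:R :> R by rewrite ltr0n.
rewrite -(ler_pM2l m0) divff ?gt_eqF// -[X in X * _](gtr0_norm m0) -normrM.
rewrite mulrBr mulrCA divff ?gt_eqF// mulr1.
have := floor_le (m.+1%:R * v 0 j); have := floorD1_gt (m.+1%:R * v 0 j).
by rewrite intrD => *; rewrite ger0_norm; lra.
Qed.

(** The argument y is rounded to a grid of mesh 1/(m+1): the rounded function
    is glued from countably many functions that are measurable in the second
    variable, and continuity gives the limit. *)
Lemma measurable_fun_caratheodory (H : 'rV[R]_n -> Z -> R) (y : T -> 'rV[R]_n)
    (zeta : T -> Z) :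
  (forall z, continuous (H ^~ z)) ->
  (forall v, measurable_fun [set: Z] (H v)) ->
  measurable_rV y -> measurable_fun [set: T] zeta ->
  measurable_fun [set: T] (fun w => H (y w) (zeta w)).
Proof.
move=> cH mH my mzeta.
apply: (@measurable_fun_cvg _ _ _ setT
  (fun m w => H (grid_point m (grid m (y w))) (zeta w))) => [m|w _].
  apply: (@measurable_countable_glue _ (fun w => grid m (y w))
    (fun q w => H (grid_point m q) (zeta w))) => [q|q];
      last exact: measurableT_comp.
  have -> : [set w | grid m (y w) = q] =
      \bigcap_(i in [set: 'I_n]) ((fun w => m.+1%:R * y w 0 i) @^-1`
        `[(q 0 i)%:~R, (q 0 i + 1)%:~R[).
    apply/seteqP; split=> [w <- i _|w qw] /=.
      by rewrite mxE in_itv/= floor_itv.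
    apply/rowP => i; rewrite mxE; apply/eqP; rewrite floor_eq.
    by have := qw i Logic.I; rewrite /= in_itv.
  apply: fin_bigcap_measurable => [|i _]; first exact: finite_finset.
  rewrite -[X in measurable X]setTI.
  by apply: (measurable_funM (measurable_cst _) (my i)) => //;
    exact: measurable_itv.
have := cH (zeta w) (y w); rewrite /continuous_at => /cvgrPdist_lt cv.
apply/cvgrPdist_lt => e e0.
have /nbhs_ballP[r /= r0 Hr] := cv e e0.
near=> m; apply: Hr; rewrite -ball_normE /=.
apply: (le_lt_trans (grid_dist _ _)).
by near: m; exact: near_infty_natSinv_lt (PosNum r0).
Unshelve. all: by end_near. Qed.

End caratheodory.

(** * Independence and iterated integrals *)

Section grouping.
Context d (Omega : measurableType d) (R : realType) (P : probability Omega R).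
Context (I : eqType) (D : set I) (S : I -> set (set Omega)).
Hypothesis S_measurable : forall j, D j -> S j `<=` measurable.
Hypothesis S_setT : forall j, D j -> S j setT.
Hypothesis S_setI : forall j, D j -> setI_closed (S j).
Hypothesis independence : mutually_independent P D S.

(** Finite intersections of events drawn from distinct members of the family:
    the pi-system that generates the same sigma-algebra as their union. *)
Let cylinder (J : set I) (C : set Omega) : Prop :=
  exists (s : seq I) (A : I -> set Omega),
    [/\ uniq s, forall j, j \in s -> J j, forall j, j \in s -> S j (A j)
      & C = \bigcap_(j in [set` s]) A j].

Let cylinder_setI J : J `<=` D -> setI_closed (cylinder J).
Proof.
move=> JD _ _ [s [A [us sJ sA ->]]] [s' [A' [us' sJ' sA' ->]]].
pose E (r : seq I) (F : I -> set Omega) j := if j \in r then F j else setT.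
exists (undup (s ++ s')), (fun j => E s A j `&` E s' A' j); split.
- exact: undup_uniq.
- by move=> j; rewrite mem_undup mem_cat => /orP[/sJ|/sJ'].
- move=> j; rewrite mem_undup mem_cat => js.
  have Dj : D j by case/orP: js => [/sJ|/sJ'] /JD.
  apply: S_setI => //; rewrite /E; case: ifPn => ?;
    by [exact: sA|exact: sA'|exact: S_setT].
- apply/seteqP; split=> w.
    move=> [As As'] j /=; rewrite mem_undup mem_cat => js; split; rewrite /E.
      by case: ifPn => // ?; exact: As.
    by case: ifPn => // ?; exact: As'.
  move=> AA; split=> j /= js.
    by have [] := AA j; rewrite /= ?mem_undup ?mem_cat ?js//; rewrite /E js.
  by have [] := AA j; rewrite /= ?mem_undup ?mem_cat ?js ?orbT//; rewrite /E js.
Qed.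

(** The finite measures P (A `&` B) and P A * P B, as functions of A, agree
    on the pi-system of cylinders. *)
Lemma independent_of_group (J : set I) (j0 : I) (A B : set Omega) :
  J `<=` D -> D j0 -> ~ J j0 -> <<s \bigcup_(j in J) S j >> A -> S j0 B ->
  P (A `&` B) = (P A * P B)%E.
Proof.
move=> JD Dj0 Jj0 GA SB.
have mB : measurable B by exact: S_measurable SB.
have PB0 : 0 <= fine (P B) by rewrite fine_ge0.
have PB : (fine (P B))%:E = P B by rewrite fineK// fin_num_measure.
have cylinder_sub : cylinder J `<=` measurable.
  move=> _ [s [F [_ sJ sF ->]]]; apply: fin_bigcap_measurable => // j js.
  by apply: S_measurable (sF j js); exact/JD/sJ.
have sub_cylinder : \bigcup_(j in J) S j `<=` cylinder J.
  move=> C [j Jj SC]; exists [:: j], (fun=> C); split=> // [i|i|].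
  - by rewrite inE => /eqP ->.
  - by rewrite inE => /eqP ->.
  - apply/seteqP; split=> [w Cw i //|w]; apply; exact: mem_head.
have mA : measurable A.
  apply: smallest_sub GA; first exact: sigma_algebra_measurable.
  by move=> C /sub_cylinder; exact: cylinder_sub.
pose m1 : {measure set Omega -> \bar R} := mrestr P mB.
pose m2 : {measure set Omega -> \bar R} := mscale (NngNum PB0) P.
have cyl : forall C, cylinder J C -> m1 C = m2 C.
  move=> _ [s [F [us sJ sF ->]]];
  change (P (\bigcap_(j in [set` s]) F j `&` B) =
    (fine (P B))%:E * P (\bigcap_(j in [set` s]) F j))%E.
  pose F' j := if j == j0 then B else F j.
  have j0s : j0 \notin s by apply/negP => /sJ.
  have F'E j : j \in s -> F' j = F j.
    by move=> js; rewrite /F'; case: eqVneq => // jj0; rewrite -jj0 js in j0s.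
  have -> : \bigcap_(j in [set` s]) F j `&` B = \bigcap_(j in [set` j0 :: s]) F'
    j.
    apply/seteqP; split=> [w [Fw Bw] j /=|w Fw].
      rewrite inE => /orP[/eqP ->|js]; first by rewrite /F' eqxx.
      by rewrite F'E//; exact: Fw.
    split=> [j js|]; first by rewrite -F'E//; apply: Fw; rewrite /= inE js orbT.
    by have := Fw j0; rewrite /F' eqxx; apply; rewrite /= mem_head.
  have Dj j : j \in j0 :: s -> D j by rewrite inE => /orP[/eqP ->//|/sJ/JD].
  rewrite independence ?cons_uniq ?j0s//; last first.
    move=> j; rewrite inE => /orP[/eqP ->|js]; first by rewrite /F' eqxx.
    by rewrite F'E//; exact: sF.
  rewrite big_cons /F' eqxx PB independence//; last by move=> j /sJ/JD.
  by congr (_ * _)%E; apply: eq_big_seq => j js; rewrite -/(F' j) F'E.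
have H : cylinder J = [set C | cylinder J C /\ C `<=` setT].
  by apply/seteqP; split=> [C ?//|C []].
have := @g_sigma_algebra_measure_unique_trace _ _ _ (cylinder J) setT
  measurableT.
rewrite -H => /(_ R cylinder_sub (cylinder_setI JD) m1 m2).
have m1T : m1 setT = P B by rewrite -[LHS]/(P (setT `&` B)) setTI.
have m2T : m2 setT = P B by rewrite -[LHS]/((fine (P B))%:E * P setT)%E PB
  probability_setT mule1.
rewrite m1T m2T => /(_ erefl cyl) uniq_m.
have -> : P (A `&` B) = m2 A.
  rewrite -[LHS]/(m1 A); apply: uniq_m => //; first by rewrite -PB ltry.
  exact: sub_sigma_algebra2 sub_cylinder _ GA.
by rewrite muleC -[in RHS]PB.
Qed.
End grouping.

Section fresh_draw.
Context d (Omega : measurableType d) (R : realType) (P : probability Omega R).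
Context dH (H : measurableType dH) dZ (Z : measurableType dZ).
Context (mu : probability Z R) (h : Omega -> H) (xi : Omega -> Z).
Hypotheses (mh : measurable_fun [set: Omega] h)
  (mxi : measurable_fun [set: Omega] xi).
Hypothesis indep : forall A B, measurable A -> measurable B ->
  P (h @^-1` A `&` xi @^-1` B) = (P (h @^-1` A) * mu B)%E.

Let hM : {mfun Omega >-> H} := HB.pack h (isMeasurableFun.Build _ _ _ _ h mh).

Let pair_fun : Omega -> (H * Z)%type := fun w => (h w, xi w).
Let mpair : measurable_fun [set: Omega] pair_fun.
Proof. exact: measurable_fun_pair. Qed.
Let pairM : {mfun Omega >-> (H * Z)%type} :=
  HB.pack pair_fun (isMeasurableFun.Build _ _ _ _ pair_fun mpair).

(** Independence says that the law of the pair is a product measure, so that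
    the integrals below become iterated. *)
Let joint_law : forall X : set (H * Z), measurable X ->
  (distribution P hM \x mu)%E X = distribution P pairM X.
Proof. by apply: product_measure_unique => A B mA mB; rewrite /distribution/=;
  exact: indep. Qed.

Lemma ge0_integral_fresh (Psi : H * Z -> \bar R) :
  measurable_fun [set: H * Z] Psi -> (forall x, 0 <= Psi x)%E ->
  (\int[P]_w Psi (h w, xi w) = \int[P]_w \int[mu]_z Psi (h w, z))%E.
Proof.
move=> mP P0.
rewrite -(@ge0_integral_distribution _ _ _ _ _ P pairM)//.
rewrite (eq_measure_integral (distribution P hM \x mu)%E);
  last by move=> A mA _; first [exact: joint_law|exact/esym/joint_law].
rewrite fubini_tonelli1//.
rewrite (@ge0_integral_distribution _ _ _ _ _ P hM)//.
  exact: measurable_fun_fubini_tonelli_F.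
by move=> y; apply: integral_ge0.
Qed.

Lemma integral_fresh (Psi : H * Z -> \bar R) :
  measurable_fun [set: H * Z] Psi ->
  P.-integrable [set: Omega] (fun w => Psi (h w, xi w)) ->
  (\int[P]_w Psi (h w, xi w) = \int[P]_w \int[mu]_z Psi (h w, z))%E.
Proof.
move=> mP iP.
rewrite -(@integral_distribution _ _ _ _ _ P pairM)//.
rewrite (eq_measure_integral (distribution P hM \x mu)%E);
  last by move=> A mA _; first [exact: joint_law|exact/esym/joint_law].
have iPsi : (distribution P hM \x mu)%E.-integrable [set: H * Z] Psi.
  apply/integrableP; split=> //; case/integrableP: iP => _; apply: le_lt_trans.
  rewrite (eq_measure_integral (distribution P pairM)); last by move=> A mA _;
    exact: joint_law.
  rewrite (@ge0_integral_distribution _ _ _ _ _ P pairM)//.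
  exact: measurableT_comp.
rewrite -integral12_prod_meas1//.
have mF := measurable_fubini_F iPsi.
rewrite (@integral_distribution _ _ _ _ _ P hM)//.
apply/integrableP; split; first exact: measurableT_comp.
have /integrableP[_] := integrable_fubini_F iPsi.
rewrite (@ge0_integral_distribution _ _ _ _ _ P hM)//.
exact: measurableT_comp.
Qed.
End fresh_draw.

(** * Square-integrable variables and minibatches *)

Section square_integrable.
Context d (Omega : measurableType d) (R : realType) (P : probability Omega R).
Implicit Types Y Z : Omega -> R.

Definition integrable_fun Y : Prop :=
  P.-integrable [set: Omega] (EFin \o Y).

Definition square_integrable Y : Prop :=
  measurable_fun [set: Omega] Y /\ integrable_fun (fun w => Y w ^+ 2).

Lemma integrable_fun_le Y Z : measurable_fun [set: Omega] Y ->
  integrable_fun Z -> (forall w, `|Y w| <= Z w) -> integrable_fun Y.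
Proof.
move=> mY iZ YZ; apply: le_integrable iZ => //; first exact/measurable_EFinP.
by move=> w _ /=; rewrite lee_fin (le_trans (YZ w))// ler_norm.
Qed.

Lemma integrable_funD Y Z : integrable_fun Y -> integrable_fun Z ->
  integrable_fun (fun w => Y w + Z w).
Proof. by move=> iY iZ; have := integrableD measurableT iY iZ. Qed.

Lemma integrable_funZ (c : R) Y : integrable_fun Y ->
  integrable_fun (fun w => c * Y w).
Proof. by move=> iY; have := integrableZl measurableT c iY. Qed.

Lemma integrable_fun_sum (I : Type) (s : seq I) (Y : I -> Omega -> R) :
  (forall i, integrable_fun (Y i)) ->
  integrable_fun (fun w => \sum_(i <- s) Y i w).
Proof.
move=> iY; elim: s => [|i s IH].
  rewrite (_ : (fun w => _) = fun=> 0); last by apply/funext => w;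
    rewrite big_nil.
  exact: integrable0.
rewrite (_ : (fun w => _) = fun w => Y i w + \sum_(j <- s) Y j w).
  exact: integrable_funD.
by apply/funext => w; rewrite big_cons.
Qed.

Lemma integrable_fun_cst (c : R) : integrable_fun (fun=> c).
Proof. exact: finite_measure_integrable_cst. Qed.

Lemma Rintegral_fun_sum (I : Type) (s : seq I) (Y : I -> Omega -> R) :
  (forall i, integrable_fun (Y i)) ->
  \int[P]_w (\sum_(i <- s) Y i w) = \sum_(i <- s) \int[P]_w Y i w.
Proof.
move=> iY; elim: s => [|i s IH].
  rewrite big_nil (_ : (fun w => _) = cst 0); last by apply/funext => w;
    rewrite big_nil.
  by rewrite Rintegral_cst// mul0r.
rewrite (_ : (fun w => _) = fun w => Y i w + \sum_(j <- s) Y j w).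
  rewrite RintegralD// ?big_cons ?IH//; first exact: (iY i).
  exact: (integrable_fun_sum s iY).
by apply/funext => w; rewrite big_cons.
Qed.

Lemma square_integrable_mul Y Z : square_integrable Y -> square_integrable Z ->
  integrable_fun (fun w => Y w * Z w).
Proof.
move=> [mY iY] [mZ iZ].
apply: (integrable_fun_le _ (integrable_funD iY iZ));
  first exact: measurable_funM.
move=> w; rewrite normrM -(real_normK (num_real (Y w)))
  -(real_normK (num_real (Z w))).
by have := sqr_ge0 (`|Y w| - `|Z w|); have := normr_ge0 (Y w);
  have := normr_ge0 (Z w); nra.
Qed.

Lemma square_integrableD Y Z : square_integrable Y -> square_integrable Z ->
  square_integrable (fun w => Y w + Z w).
Proof.
move=> sY sZ; have iYZ := square_integrable_mul sY sZ.
case: sY sZ => mY iY [mZ iZ]; split; first exact: measurable_funD.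
have := integrable_funD (integrable_funD iY iZ) (integrable_funZ 2 iYZ).
by congr (integrable_fun _); apply/funext => w /=; ring.
Qed.

Lemma square_integrableZ (c : R) Y : square_integrable Y ->
  square_integrable (fun w => c * Y w).
Proof.
move=> [mY iY]; split; first exact: measurable_funM.
have := integrable_funZ (c ^+ 2) iY.
by congr (integrable_fun _); apply/funext => w /=; ring.
Qed.

Lemma square_integrable_bounded Y (M : R) : measurable_fun [set: Omega] Y ->
  (forall w, `|Y w| <= M) -> square_integrable Y.
Proof.
move=> mY YM; split=> //.
apply: (integrable_fun_le _ (integrable_fun_cst (M ^+ 2))).
  exact: measurable_funX.
move=> w; rewrite ger0_norm ?sqr_ge0// -(real_normK (num_real (Y w))).
by rewrite lerXn2r ?nnegrE// (le_trans _ (YM w)).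
Qed.

Lemma integrable_fun_ge0_lty Y : measurable_fun [set: Omega] Y ->
  (forall w, 0 <= Y w) -> (\int[P]_w (Y w)%:E < +oo)%E -> integrable_fun Y.
Proof.
move=> mY Y0 Yoo; apply/integrableP; split; first exact/measurable_EFinP.
by under eq_integral => w _ do rewrite gee0_abs ?lee_fin//.
Qed.

Lemma Rintegral_prob_cst (c : R) : \int[P]_w c = c.
Proof.
by have /(congr1 fine) := expectation_cst P c; rewrite unlock.
Qed.

Lemma EFin_Rintegral Y : integrable_fun Y ->
  (\int[P]_w Y w)%:E = (\int[P]_w (Y w)%:E)%E.
Proof. by move=> iY; rewrite fineK//; exact: integrable_fin_num. Qed.

End square_integrable.

Section sub_sigma_algebra.
Context d (Omega : measurableType d) dT (T : measurableType dT).

(** The sigma-algebra generated by G is a second measurable structure on the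
    same carrier Omega. *)
Definition adapted (G : set (set Omega)) (Y : Omega -> T) : Prop :=
  measurable_fun [set: g_sigma_algebraType G] (Y : g_sigma_algebraType G -> T).

Lemma adaptedS (G G' : set (set Omega)) Y :
  G `<=` G' -> adapted G Y -> adapted G' Y.
Proof.
move=> GG' aY _ B mB; have := aY measurableT B mB.
by rewrite /measurable/=; exact: sub_sigma_algebra2.
Qed.

Lemma adapted_measurable (G : set (set Omega)) Y : G `<=` measurable ->
  adapted G Y -> measurable_fun [set: Omega] Y.
Proof.
move=> mG aY _ B mB; have := aY measurableT B mB; rewrite {1}/measurable/=.
by apply: smallest_sub mG _; exact: sigma_algebra_measurable.
Qed.
End sub_sigma_algebra.

Section minibatch.
Context d (Omega : measurableType d) (R : realType) (P : probability Omega R).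
Context dZ (Z : measurableType dZ) (mu : probability Z R).

(** With A the whole space, the second clause says also that xi has law mu. *)
Definition fresh (G : set (set Omega)) (xi : Omega -> Z) : Prop :=
  measurable_fun [set: Omega] xi /\
  forall A B, <<s G >> A -> measurable B ->
    P (A `&` xi @^-1` B) = (P A * mu B)%E.

Definition jointly_measurable (G : set (set Omega))
    (phi : Omega -> Z -> R) : Prop :=
  measurable_fun [set: g_sigma_algebraType G * Z] (fun p => phi p.1 p.2).

Lemma id_adapted (G : set (set Omega)) : G `<=` measurable ->
  measurable_fun [set: Omega] (id : Omega -> g_sigma_algebraType G).
Proof.
move=> mG _ B mB; rewrite setTI; move: mB; rewrite {1}/measurable/=.
by apply: smallest_sub mG _; exact: sigma_algebra_measurable.
Qed.

Lemma jointly_measurableS (G G' : set (set Omega)) phi : G `<=` G' ->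
  jointly_measurable G phi -> jointly_measurable G' phi.
Proof.
move=> GG' jphi; have idm : adapted G' (id : Omega -> g_sigma_algebraType G).
  by apply: (adaptedS GG'); exact: measurable_id.
have mg : measurable_fun [set: g_sigma_algebraType G' * Z]
    (fun p => (p.1 : g_sigma_algebraType G, p.2)).
  by apply: measurable_fun_pair => //; exact: measurableT_comp idm
    measurable_fst.
exact: (measurableT_comp jphi mg).
Qed.

Lemma adapted_plug (G G' : set (set Omega)) phi (xi : Omega -> Z) : G `<=` G' ->
  jointly_measurable G phi -> adapted G' xi ->
  adapted G' (fun w => phi w (xi w)).
Proof.
move=> GG' jphi axi.
have mg : measurable_fun [set: g_sigma_algebraType G']
    (fun w => (w : g_sigma_algebraType G, xi w)).
  apply: measurable_fun_pair => //.
  by apply: (adaptedS GG'); exact: measurable_id.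
exact: (measurableT_comp jphi mg).
Qed.

Section one_draw.
Variables (G : set (set Omega)) (xi : Omega -> Z) (phi : Omega -> Z -> R).
Hypotheses (mG : G `<=` measurable) (xi_fresh : fresh G xi).
Hypothesis jphi : jointly_measurable G phi.

Let indep : forall (A : set (g_sigma_algebraType G)) B, measurable A ->
  measurable B ->
  P (id @^-1` A `&` xi @^-1` B) = (P (id @^-1` A) * mu B)%E.
Proof. by move=> A B mA mB; apply: xi_fresh.2. Qed.

Lemma measurable_plug : measurable_fun [set: Omega] (fun w => phi w (xi w)).
Proof.
have mg : measurable_fun [set: Omega]
  (fun w => (w : g_sigma_algebraType G, xi w)).
  by apply: measurable_fun_pair; [exact: id_adapted|exact: xi_fresh.1].
exact: (measurableT_comp jphi mg).
Qed.

Lemma fresh_second_moment :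
  (\int[P]_w ((phi w (xi w)) ^+ 2)%:E =
   \int[P]_w \int[mu]_z ((phi w z) ^+ 2)%:E)%E.
Proof.
apply: (@ge0_integral_fresh _ _ _ P _ _ _ _ mu _ _ (id_adapted mG) xi_fresh.1
  indep
  (fun p => ((phi p.1 p.2) ^+ 2)%:E)).
  by apply/measurable_EFinP; exact: measurable_funX.
by move=> p; rewrite lee_fin sqr_ge0.
Qed.

(** Y is constant while the draw is integrated. *)
Lemma fresh_orthogonal (Y : Omega -> R) :
  adapted G Y -> square_integrable P Y ->
  square_integrable P (fun w => phi w (xi w)) ->
  (forall w, mu.-integrable [set: Z] (EFin \o phi w)) ->
  (forall w, (\int[mu]_z (phi w z)%:E = 0)%E) ->
  \int[P]_w (Y w * phi w (xi w)) = 0.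
Proof.
move=> aY sY sphi iphi phi0; rewrite /Rintegral.
have := @integral_fresh _ _ _ P _ _ _ _ mu _ _ (id_adapted mG) xi_fresh.1 indep
  (fun p => (Y p.1 * phi p.1 p.2)%:E).
move=> ->.
- rewrite (_ : (fun w => _) = cst 0%E); first by rewrite integral_cst// mul0e.
  apply/funext => w /=; transitivity ((Y w)%:E * \int[mu]_z (phi w z)%:E)%E.
    under eq_integral do rewrite EFinM.
    exact: (integralZl measurableT (iphi w)).
  by rewrite phi0 mule0.
- apply/measurable_EFinP; apply: measurable_funM => //.
  exact: measurableT_comp aY measurable_fst.
- exact: square_integrable_mul sY sphi.
Qed.
End one_draw.

Section batch.
Variables (G : nat -> set (set Omega)) (xi : nat -> Omega -> Z) (m : nat).
Variables (phi : Omega -> Z -> R) (Y : Omega -> R) (beta : R).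
Hypothesis mG : forall i, G i `<=` measurable.
Hypothesis GS : forall i, G i `<=` G i.+1.
Hypothesis xi_fresh : forall i, (i < m)%N -> fresh (G i) (xi i).
Hypothesis xi_adapted : forall i, (i < m)%N -> adapted (G i.+1) (xi i).
Hypothesis jphi : jointly_measurable (G 0%N) phi.
Hypothesis iphi : forall w, mu.-integrable [set: Z] (EFin \o phi w).
Hypothesis phi_mean0 : forall w, (\int[mu]_z (phi w z)%:E = 0)%E.
Hypothesis phi_lty : (\int[P]_w \int[mu]_z ((phi w z) ^+ 2)%:E < +oo)%E.
Hypotheses (aY : adapted (G 0%N) Y) (sY : square_integrable P Y).

Let partial i w : R := Y w + beta * \sum_(j < i) phi w (xi j w).

Let q : R := fine (\int[P]_w \int[mu]_z ((phi w z) ^+ 2)%:E)%E.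

Let G0 i : G 0%N `<=` G i.
Proof. by elim: i => // i IH A /IH; exact: GS. Qed.

(** Each draw adds an increment that is orthogonal to everything known before
    it: second moments add up, and products with variables of the initial
    history keep their expectation. *)
Lemma batch_moments i : (i <= m)%N ->
  [/\ adapted (G i) (partial i), square_integrable P (partial i),
      \int[P]_w (partial i w ^+ 2) = \int[P]_w (Y w ^+ 2) + i%:R * beta ^+ 2 * q
    & forall V, adapted (G 0%N) V -> square_integrable P V ->
      \int[P]_w (partial i w * V w) = \int[P]_w (Y w * V w)].
Proof.
elim: i => [|i IH] im.
  have -> : partial 0%N = Y.
    by apply/funext => w; rewrite /partial big_ord0 mulr0 addr0.
  by split=> //; rewrite !mul0r addr0.
have [aD sD D2 DV] := IH (ltnW im).
have partialS : partial i.+1 = fun w => partial i w + beta * phi w (xi i w).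
  by apply/funext => w; rewrite /partial big_ord_recr/= mulrDr addrA.
have jphi_i := jointly_measurableS (@G0 i) jphi.
have phi2 := fresh_second_moment (@mG i) (xi_fresh im) jphi_i.
have mphi := measurable_plug (@mG i) (xi_fresh im) jphi_i.
have sphi : square_integrable P (fun w => phi w (xi i w)).
  split=> //; apply: integrable_fun_ge0_lty; first exact: measurable_funX.
    by move=> w; exact: sqr_ge0.
  by rewrite phi2.
have sbphi := square_integrableZ beta sphi.
have orth V : adapted (G i) V -> square_integrable P V ->
    \int[P]_w (V w * (beta * phi w (xi i w))) = 0.
  move=> aV sV.
  have -> : (fun w => V w * (beta * phi w (xi i w))) =
      fun w => beta * (V w * phi w (xi i w)) by apply/funext => w;
        rewrite mulrCA.
  rewrite RintegralZl//; last exact: (square_integrable_mul sV sphi).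
  by rewrite (fresh_orthogonal (@mG i) (xi_fresh im) jphi_i)// mulr0.
rewrite partialS; split.
- have aphi := adapted_plug (@G0 i.+1) jphi (xi_adapted im).
  exact: (measurable_funD (adaptedS (@GS i) aD)
    (measurable_funM (measurable_cst beta) aphi)).
- exact: square_integrableD.
- have -> : (fun w => (partial i w + beta * phi w (xi i w)) ^+ 2) =
      fun w => partial i w ^+ 2 + (2 * (partial i w * (beta * phi w (xi i w)))
        + beta ^+ 2 * (phi w (xi i w)) ^+ 2) by apply/funext => w; ring.
  have i1 := sD.2; have i2 := square_integrable_mul sD sbphi; have i3 := sphi.2.
  rewrite RintegralD//; last first.
    by apply: integrable_funD; exact: integrable_funZ.
  rewrite RintegralD//; [|exact: integrable_funZ|exact: integrable_funZ].
  rewrite !RintegralZl// orth// D2.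
  have -> : \int[P]_w (phi w (xi i w)) ^+ 2 = q by rewrite /Rintegral phi2.
  by rewrite -(natr1 i); ring.
- move=> V aV sV.
  have -> : (fun w => (partial i w + beta * phi w (xi i w)) * V w) =
      fun w => partial i w * V w + V w * (beta * phi w (xi i w)) by apply/funext
        => w; ring.
  rewrite RintegralD//; [|exact: square_integrable_mul sD sV|exact:
    square_integrable_mul sV sbphi].
  by rewrite DV// orth ?addr0//; exact: adaptedS (@G0 i) aV.
Qed.
End batch.
End minibatch.

Section random_vectors.
Context d (Omega : measurableType d) (R : realType) (P : probability Omega R)
  (n : nat).
Implicit Types U V : Omega -> 'rV[R]_n.

Definition vadapted (G : set (set Omega)) U : Prop :=
  forall i, adapted G (fun w => U w 0 i).

Definition vsquare_integrable U : Prop :=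
  forall i, square_integrable P (fun w => U w 0 i).

Lemma vadaptedS (G G' : set (set Omega)) U : G `<=` G' -> vadapted G U ->
  vadapted G' U.
Proof. by move=> GG' aU i; exact: adaptedS (aU i). Qed.

Lemma vadaptedD G U V : vadapted G U -> vadapted G V ->
  vadapted G (fun w => U w + V w).
Proof.
move=> aU aV i; have := measurable_funD (aU i) (aV i).
by congr (measurable_fun _ _); apply/funext => w; rewrite mxE.
Qed.

Lemma vadaptedZ G (c : R) U : vadapted G U -> vadapted G (fun w => c *: U w).
Proof.
move=> aU i; have := measurable_funM (measurable_cst c) (aU i).
by congr (measurable_fun _ _); apply/funext => w; rewrite mxE.
Qed.

Lemma vadaptedB G U V : vadapted G U -> vadapted G V ->
  vadapted G (fun w => U w - V w).
Proof.
move=> aU aV; have := vadaptedD aU (vadaptedZ (-1) aV).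
by congr vadapted; apply/funext => w; rewrite scaleN1r.
Qed.

Lemma vadapted_cst G (v : 'rV[R]_n) : vadapted G (fun=> v).
Proof. by move=> i; exact: measurable_cst. Qed.

Lemma vsquare_integrableD U V : vsquare_integrable U -> vsquare_integrable V ->
  vsquare_integrable (fun w => U w + V w).
Proof.
move=> sU sV i; have := square_integrableD (sU i) (sV i).
by congr square_integrable; apply/funext => w; rewrite mxE.
Qed.

Lemma integrable_dotv U V : vsquare_integrable U -> vsquare_integrable V ->
  integrable_fun P (fun w => dotv (U w) (V w)).
Proof.
by move=> sU sV; apply: integrable_fun_sum => i; exact: square_integrable_mul.
Qed.

Lemma Rintegral_dotv U V : vsquare_integrable U -> vsquare_integrable V ->
  \int[P]_w dotv (U w) (V w) = \sum_i \int[P]_w (U w 0 i * V w 0 i).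
Proof.
by move=> sU sV; apply: Rintegral_fun_sum => i; exact: square_integrable_mul.
Qed.

(** Only the sum over the coordinates of the second moments is controlled, by
    c; the finiteness that each coordinate requires is derived from it. *)
Section vector_batch.
Context dZ (Z : measurableType dZ) (mu : probability Z R).
Variables (G : nat -> set (set Omega)) (xi : nat -> Omega -> Z) (m : nat).
Variables (phi : Omega -> Z -> 'rV[R]_n) (Y : Omega -> 'rV[R]_n) (beta : R).
Variables (c : Omega -> R) (D : Omega -> 'rV[R]_n).
Hypothesis mG : forall i, G i `<=` measurable.
Hypothesis GS : forall i, G i `<=` G i.+1.
Hypothesis xi_fresh : forall i, (i < m)%N -> fresh P mu (G i) (xi i).
Hypothesis xi_adapted : forall i, (i < m)%N -> adapted (G i.+1) (xi i).
Hypothesis jphi : forall i, jointly_measurable (G 0%N) (fun w z => phi w z 0 i).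
Hypothesis iphi : forall w i, mu.-integrable [set: Z]
  (fun z => (phi w z 0 i)%:E).
Hypothesis phi_mean0 : forall w i, (\int[mu]_z (phi w z 0 i)%:E = 0)%E.
Hypothesis ic : integrable_fun P c.
Hypothesis phi_second_moment : forall w,
  (\int[mu]_z (dotv (phi w z) (phi w z))%:E <= (c w)%:E)%E.
Hypotheses (aY : vadapted (G 0%N) Y) (sY : vsquare_integrable Y).

Hypothesis DE : forall w, D w = Y w + beta *: \sum_(j < m) phi w (xi j w).

Let r (i : 'I_n) w := (\int[mu]_z ((phi w z 0 i) ^+ 2)%:E)%E.

Let mphi2 w i : measurable_fun [set: Z] (fun z => ((phi w z 0 i) ^+ 2)%:E).
Proof.
apply/measurable_EFinP; apply: measurable_funX.
by apply/measurable_EFinP; exact: measurable_int (iphi w i).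
Qed.

Let sum_r w : (\sum_i r i w <= (c w)%:E)%E.
Proof.
rewrite -ge0_integral_sum//; last by move=> i z _; rewrite lee_fin sqr_ge0.
apply: le_trans (phi_second_moment w).
by under [leRHS]eq_integral do rewrite -sumEFin.
Qed.

Let mr i : measurable_fun [set: Omega] (r i).
Proof.
have mF := @measurable_fun_fubini_tonelli_F _ _ (g_sigma_algebraType (G 0%N)) Z
  R
  mu (fun p => ((phi p.1 p.2 0 i) ^+ 2)%:E).
apply: adapted_measurable (@mG 0%N) _; apply: mF.
  by apply/measurable_EFinP/measurable_funX; exact: jphi.
by move=> p; rewrite lee_fin sqr_ge0.
Qed.

Let r_ge0 i w : (0 <= r i w)%E.
Proof. by apply: integral_ge0 => z _; rewrite lee_fin sqr_ge0. Qed.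

Let sum_q : (\sum_i \int[P]_w r i w <= (\int[P]_w c w)%:E)%E.
Proof.
have -> : (\int[P]_w c w)%:E = (\int[P]_w (c w)%:E)%E by exact: EFin_Rintegral.
rewrite -ge0_integral_sum//.
apply: ge0_le_integral => //.
- by move=> w _; apply: sume_ge0.
- exact: emeasurable_sum.
- by apply/measurable_EFinP; have /integrableP[/measurable_EFinP] := ic.
Qed.

Let q_lty i : (\int[P]_w r i w < +oo)%E.
Proof.
apply: le_lt_trans (ltry (\int[P]_w c w)); apply: le_trans sum_q.
rewrite (bigD1 i)//= leeDl//; apply: sume_ge0 => j _.
by apply: integral_ge0.
Qed.

Lemma vector_batch_moments :
  [/\ vadapted (G m) D, vsquare_integrable D,
      \int[P]_w dotv (D w) (D w)
        <= \int[P]_w dotv (Y w) (Y w) + m%:R * beta ^+ 2 * \int[P]_w c w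
    & forall V, vadapted (G 0%N) V -> vsquare_integrable V ->
      \int[P]_w dotv (D w) (V w) = \int[P]_w dotv (Y w) (V w)].
Proof.
have coordD i : (fun w => D w 0 i) =
    fun w => Y w 0 i + beta * \sum_(j < m) phi w (xi j w) 0 i.
  by apply/funext => w; rewrite DE !mxE summxE.
have B i := @batch_moments _ _ _ P _ _ mu G xi m (fun w z => phi w z 0 i)
  (fun w => Y w 0 i) beta mG GS xi_fresh xi_adapted (jphi i) (iphi ^~ i)
  (phi_mean0 ^~ i) (q_lty i) (aY i) (sY i) m (leqnn m).
have aD : vadapted (G m) D by move=> i; rewrite coordD; have [] := B i.
have sD : vsquare_integrable D by move=> i; rewrite coordD; have [] := B i.
split=> //.
- rewrite !Rintegral_dotv//.
  have -> : \sum_i \int[P]_w (D w 0 i * D w 0 i) = \sum_i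
    (\int[P]_w (Y w 0 i * Y w 0 i)
      + m%:R * beta ^+ 2 * fine (\int[P]_w r i w)%E).
    apply: eq_bigr => i _; have [_ _ D2 _] := B i; rewrite -D2.
    by apply: eq_Rintegral => w _; rewrite DE !mxE summxE.
  rewrite big_split/= lerD2l -mulr_sumr ler_wpM2l//.
    by rewrite mulr_ge0// sqr_ge0.
  rewrite -lee_fin; apply: le_trans sum_q; rewrite -sumEFin.
  apply: lee_sum => i _; rewrite fineK// ge0_fin_numE ?q_lty//.
  by apply: integral_ge0.
- move=> V aV sV; rewrite !Rintegral_dotv//.
  apply: eq_bigr => i _; have [_ _ _ /(_ _ (aV i) (sV i)) <-] := B i.
  by apply: eq_Rintegral => w _; rewrite DE !mxE summxE.
Qed.
End vector_batch.
End random_vectors.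

(** * Lipschitz functions on a compact convex set *)

Section lipschitz_on_compact.
Context (R : realType) (n : nat) (X : set 'rV[R]_n).
Hypotheses (X_nonempty : X !=set0) (X_convex : convex_set X).
Hypothesis X_compact : compact X.

Let proj (v : 'rV[R]_n) := prox_step X 0 (- v) 1.

Let proj_in v : X (proj v).
Proof. by have [] := prox_stepP X_nonempty X_convex X_compact 0 (- v)
  (@ltr01 R). Qed.

Let proj_id v : X v -> proj v = v.
Proof.
move=> Xv; apply/eqP; rewrite -subr_eq0; apply/eqP/dotvv_eq0/eqP.
have [_ /(_ _ Xv)] := prox_stepP X_nonempty X_convex X_compact 0 (- v)
  (@ltr01 R).
rewrite -/(proj v) scale1r sub0r opprK addrC -(opprB (proj v) v) dotvNr
  oppr_ge0.
by move=> H; rewrite eq_le H dotvv_ge0.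
Qed.

(** Composing with the projection onto X extends a function that is Lipschitz
    on X only to a continuous one. *)
Lemma measurable_lipschitz_on d (T : measurableType d)
    d' (Z : measurableType d')
    (H : 'rV[R]_n -> Z -> R) (K : Z -> R) (y : T -> 'rV[R]_n) (zeta : T -> Z) :
  (forall z, 0 <= K z) ->
  (forall u v z, X u -> X v -> `|H u z - H v z| <= K z * enorm (u - v)) ->
  (forall u, X u -> measurable_fun [set: Z] (H u)) ->
  measurable_rV y -> (forall w, X (y w)) -> measurable_fun [set: T] zeta ->
  measurable_fun [set: T] (fun w => H (y w) (zeta w)).
Proof.
move=> K0 HK mH my Xy mzeta.
have -> : (fun w => H (y w) (zeta w)) = fun w => H (proj (y w)) (zeta w).
  by apply/funext => w; rewrite proj_id.
apply: (@measurable_fun_caratheodory _ _ _ _ _ _ (fun v z => H (proj v) z)) =>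
  // [z|v].
  apply: (@lipschitz_continuous _ _ _ (K z)) => u v.
  apply: (le_trans (HK _ _ _ (proj_in u) (proj_in v))); rewrite ler_wpM2l//.
  have := prox_step_lipschitz X_nonempty X_convex X_compact u v (@ltr01 R).
  by rewrite invr1 mul1r.
exact/mH/proj_in.
Qed.

Lemma measurable_prox_step d (T : measurableType d) (gamma : R)
    (y g : T -> 'rV[R]_n) : 0 < gamma -> measurable_rV y -> measurable_rV g ->
  measurable_rV (fun w => prox_step X (y w) (g w) gamma).
Proof.
move=> g0 my mg i.
under eq_fun do rewrite (prox_step_shift X_nonempty X_convex X_compact)//.
apply: (@measurable_fun_caratheodory _ _ _ _ _ _
  (fun v (_ : T) => prox_step X 0 (- v) gamma 0 i) (fun w => gamma *: y w - g w)
    id) => //.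
  move=> _; apply: (@lipschitz_continuous _ _ _ gamma^-1) => u v.
  apply: le_trans (prox_step_lipschitz X_nonempty X_convex X_compact u v g0).
  by apply: le_trans (coord_le_enorm _ i); rewrite !mxE.
move=> j; have := measurable_funB (measurable_funM (measurable_cst gamma)
  (my j)) (mg j).
by congr (measurable_fun _ _); apply/funext => w; rewrite !mxE.
Qed.

Lemma exists_minimizer (f : 'rV[R]_n -> R) (gradf : 'rV[R]_n -> 'rV[R]_n) :
  C1_on X f gradf -> exists2 u, X u & forall v, X v -> f u <= f v.
Proof.
move=> [grad _].
have fc : {within X, continuous f}.
  apply/subspace_continuousP => x Xx.
  have FF : Filter (within X (nbhs x)).
    by apply: within_filter; exact: nbhs_filter.
  apply/(@cvgrPdist_lt _ _ _ (within X (nbhs x))) => e e0.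
  pose K := 1 + \sum_i `|gradf x 0 i|; pose C := K * Num.sqrt n%:R + 1.
  have K0 : 0 <= K by rewrite addr_ge0// sumr_ge0.
  have C0 : 0 < C by rewrite ltr_pwDr// mulr_ge0 ?sqrtr_ge0.
  have near_x : \forall y \near within X (nbhs x), `|y - x| < e / C.
    apply: cvg_within; apply/nbhs_ballP; exists (e / C) => [|y].
      by rewrite /= divr_gt0.
    by rewrite -ball_normE /= distrC.
  apply: (@filterS _ _ FF _ _ _ (@filterI _ _ FF _ _ (grad x Xx 1 ltr01)
    near_x)) => y [fy xy].
  rewrite distrC; apply: le_lt_trans (_ : _ <= K * enorm (y - x)) _.
    rewrite -(subrK (dotv (gradf x) (y - x)) (f y - f x)) mulrDl.
    apply: (le_trans (ler_normD _ _)); rewrite lerD//.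
    rewrite mulr_suml; apply: (le_trans (ler_norm_sum _ _ _));
      apply: ler_sum => i _.
    by rewrite normrM ler_wpM2l// coord_le_enorm.
  apply: (@le_lt_trans _ _ (C * `|y - x|)).
    apply: (@le_trans _ _ (K * (Num.sqrt n%:R * `|y - x|))).
      by rewrite ler_wpM2l ?enorm_le_norm.
    by rewrite mulrA ler_wpM2r// /C lerDl.
  by rewrite mulrC -ltr_pdivlMr.
have [c cX cmin] := EVT_min_rV X_nonempty X_compact fc.
by exists c; [exact/set_mem|move=> v Xv; apply: cmin; exact/mem_set].
Qed.
End lipschitz_on_compact.

(** * The stochastic oracle *)

Section oracle.
Context (R : realType) (n : nat) (X : set 'rV[R]_n).
Context (f : 'rV[R]_n -> R) (gradf : 'rV[R]_n -> 'rV[R]_n).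
Context (d : measure_display) (Xi : measurableType d) (mu : probability Xi R).
Context (F : 'rV[R]_n -> Xi -> R) (G : 'rV[R]_n -> Xi -> 'rV[R]_n).
Context (Lip : Xi -> R) (Lhat Lbar sigma : R).
Hypothesis oracle : stochastic_oracle X f gradf mu F G Lip Lhat Lbar sigma.

Let E_def (Y : Xi -> R) : ('E_mu [Y] = \int[mu]_z (Y z)%:E)%E.
Proof. by rewrite unlock. Qed.

Let Lip2_integrable : integrable_fun mu (fun z => Lip z ^+ 2).
Proof.
apply: integrable_fun_ge0_lty;
  first exact/measurable_funX/(oracle_Lip_measurable oracle).
  by move=> z; exact: sqr_ge0.
by apply: le_lt_trans (ltry (Lbar ^+ 2)); rewrite -E_def;
  exact: oracle_Lip_moment oracle.
Qed.

Let Lip2_le : \int[mu]_z (Lip z ^+ 2) <= Lbar ^+ 2.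
Proof. by rewrite -lee_fin EFin_Rintegral// -E_def; exact: oracle_Lip_moment
  oracle. Qed.

Let G_integrable u i : X u -> integrable_fun mu (fun z => G u z 0 i).
Proof. by move=> Xu; exact: oracle_grad_integrable oracle _ _ Xu. Qed.

Let G_mean u i : X u -> \int[mu]_z (G u z 0 i) = gradf u 0 i.
Proof. by move=> Xu; rewrite /Rintegral -E_def (oracle_grad_mean oracle). Qed.

Let F_integrable u : X u -> integrable_fun mu (F u).
Proof. by move=> Xu; exact: oracle_value_integrable oracle _ Xu. Qed.

Let F_mean u : X u -> \int[mu]_z (F u z) = f u.
Proof. by move=> Xu; rewrite /Rintegral -E_def (oracle_value_mean oracle). Qed.

Lemma oracle_noise_integrable u i : X u ->
  mu.-integrable [set: Xi] (fun z => ((G u z - gradf u) 0 i)%:E).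
Proof.
move=> Xu; have := integrable_funD (G_integrable i Xu)
  (integrable_fun_cst mu (- gradf u 0 i)).
by congr (_.-integrable _ _); apply/funext => z; rewrite !mxE.
Qed.

Lemma oracle_noise_mean u i : X u ->
  (\int[mu]_z ((G u z - gradf u) 0 i)%:E = 0)%E.
Proof.
move=> Xu; rewrite -EFin_Rintegral; last exact: oracle_noise_integrable.
have -> : (fun z => (G u z - gradf u) 0 i) = fun z => G u z 0 i +
  (- gradf u 0 i).
  by apply/funext => z; rewrite !mxE.
rewrite RintegralD//; [|exact: G_integrable|exact: integrable_fun_cst].
by rewrite G_mean// Rintegral_prob_cst subrr.
Qed.

Lemma oracle_noise_variance u : X u ->
  (\int[mu]_z (dotv (G u z - gradf u) (G u z - gradf u))%:E
    <= (sigma ^+ 2)%:E)%E.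
Proof.
move=> Xu; have := oracle_variance oracle Xu; rewrite E_def.
by under eq_integral do rewrite enorm_sqr.
Qed.

(** Centring decreases the second moment, and that of G u - G v is controlled
    by the random Lipschitz constant. *)
Lemma oracle_difference_variance u v : X u -> X v ->
  (\int[mu]_z (dotv (G u z - gradf u - (G v z - gradf v))
                   (G u z - gradf u - (G v z - gradf v)))%:E
   <= (Lbar ^+ 2 * dotv (u - v) (u - v))%:E)%E.
Proof.
move=> Xu Xv; pose phi z := (G u z - gradf u) - (G v z - gradf v).
rewrite -[X in (X <= _)%E]/(\int[mu]_z (dotv (phi z) (phi z))%:E)%E.
pose g z := G u z - G v z.
have mGu i : measurable_fun [set: Xi] (fun z => G u z 0 i).
  by have /integrableP[/measurable_EFinP] := G_integrable i Xu.
have mGv i : measurable_fun [set: Xi] (fun z => G v z 0 i).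
  by have /integrableP[/measurable_EFinP] := G_integrable i Xv.
have mg i : measurable_fun [set: Xi] (fun z => g z 0 i).
  have := measurable_funB (mGu i) (mGv i).
  by congr (measurable_fun _ _); apply/funext => z; rewrite !mxE.
have iLip : integrable_fun mu (fun z => dotv (u - v) (u - v) * Lip z ^+ 2).
  exact: integrable_funZ.
have gLip z : dotv (g z) (g z) <= dotv (u - v) (u - v) * Lip z ^+ 2.
  have := oracle_lipschitz oracle z Xu Xv; rewrite -!enorm_sqr -exprMn mulrC =>
    H.
  by rewrite lerXn2r ?nnegrE ?enorm_ge0// (le_trans _ H) ?enorm_ge0.
have sg : vsquare_integrable mu g.
  move=> i; split=> //; apply: (integrable_fun_le _ iLip);
    first exact: measurable_funX.
  move=> z; rewrite ger0_norm ?sqr_ge0//; apply: le_trans (gLip z).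
  by rewrite /dotv (bigD1 i)//= -expr2 lerDl; apply: sumr_ge0 => j _;
    rewrite -expr2 sqr_ge0.
pose c := gradf u - gradf v.
have sc : vsquare_integrable mu (fun=> - c).
  by move=> i; apply: (@square_integrable_bounded _ _ _ _ _ `|(- c) 0 i|).
have phiE : phi = fun z => g z + - c.
  by apply/funext => z; apply/rowP => i; rewrite !mxE; ring.
have sphi : vsquare_integrable mu phi by rewrite phiE;
  exact: vsquare_integrableD.
have igg := integrable_dotv sg sg.
rewrite -EFin_Rintegral; last exact: integrable_dotv.
rewrite lee_fin; apply: (@le_trans _ _ (\int[mu]_z dotv (g z) (g z))).
  have mean_gc : \int[mu]_z dotv (g z) (- c) = - dotv c c.
    rewrite Rintegral_dotv// -dotvNr; apply: eq_bigr => i _.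
    have -> : (fun z => g z 0 i * (- c) 0 i) = fun z => (- c) 0 i * g z 0 i.
      by apply/funext => z; rewrite mulrC.
    have ig : integrable_fun mu (fun z => g z 0 i).
      have := integrable_funD (G_integrable i Xu)
        (integrable_funZ (-1) (G_integrable i Xv)).
      by congr (integrable_fun _ _); apply/funext => z; rewrite !mxE mulN1r.
    rewrite RintegralZl// mulrC; congr (_ * _).
    have -> : (fun z => g z 0 i) = fun z => G u z 0 i - G v z 0 i.
      by apply/funext => z; rewrite !mxE.
    by rewrite RintegralB ?G_mean ?mxE//; exact: G_integrable.
  have -> : (fun z => dotv (phi z) (phi z)) =
      fun z => dotv (g z) (g z) + (2 * dotv (g z) (- c) + dotv c c).
    apply/funext => z; rewrite phiE.
    have -> : dotv c c = dotv (- c) (- c) by rewrite dotvNl dotvNr opprK.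
    by rewrite (dotvDl (g z) (- c)) !(dotvDr _ (g z) (- c)) (dotvC (- c) (g z));
      ring.
  have igc := integrable_dotv sg sc; have i1 := integrable_fun_cst mu
    (dotv c c).
  rewrite RintegralD//; last exact: (integrable_funD (integrable_funZ 2 igc)
    i1).
  rewrite gerDl RintegralD//; last exact: (integrable_funZ 2 igc).
  rewrite RintegralZl// mean_gc Rintegral_prob_cst.
  by have := dotvv_ge0 c; lra.
apply: (@le_trans _ _ (\int[mu]_z (dotv (u - v) (u - v) * Lip z ^+ 2))).
  by apply: le_Rintegral => // z _; exact: gLip.
by rewrite RintegralZl// mulrC ler_wpM2r// dotvv_ge0.
Qed.

(** The average of the upper curvature bounds of the samples. The square in
    the moment condition is reached through 2 Lip <= gamma / 4 + (4 / gamma)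
    Lip^2, which, unlike a division by Lbar, makes sense when Lbar = 0. *)
Lemma oracle_smoothness gamma u v :
  0 < gamma -> 0 <= Lbar -> 4 * Lbar <= gamma -> X u -> X v ->
  f u - f v - dotv (gradf v) (u - v) <= gamma / 8 * enorm (u - v) ^+ 2.
Proof.
move=> g0 Lb0 gL Xu Xv; set a := enorm (u - v) ^+ 2.
have a0 : 0 <= a by exact: sqr_ge0.
have iG : integrable_fun mu (fun z => dotv (G v z) (u - v)).
  apply: integrable_fun_sum => i.
  have := integrable_funZ ((u - v) 0 i) (G_integrable i Xv).
  by congr (integrable_fun _ _); apply/funext => z; rewrite mulrC.
have mean_G : \int[mu]_z dotv (G v z) (u - v) = dotv (gradf v) (u - v).
  rewrite Rintegral_fun_sum => [|i]; last first.
    have := integrable_funZ ((u - v) 0 i) (G_integrable i Xv).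
    by congr (integrable_fun _ _); apply/funext => z; rewrite mulrC.
  apply: eq_bigr => i _.
  by rewrite RintegralZr ?G_mean//; exact: G_integrable.
have iL : integrable_fun mu (fun z => a / gamma * Lip z ^+ 2) by exact:
  integrable_funZ.
have i1 := integrable_fun_cst mu (gamma / 16 * a).
have iF : integrable_fun mu (fun z => F u z - F v z).
  by have := integrableB measurableT (F_integrable Xu) (F_integrable Xv).
rewrite -mean_G -(F_mean Xu) -(F_mean Xv).
rewrite -RintegralB//; [|exact: F_integrable|exact: F_integrable].
rewrite -RintegralB//.
apply: (@le_trans _ _ (\int[mu]_z (a / gamma * Lip z ^+ 2 + gamma / 16 * a))).
  apply: le_Rintegral => //.
  - by have := integrableB measurableT iF iG.
  - exact: integrable_funD.
  move=> z _; apply: (le_trans (oracle_upper_curvature oracle z Xu Xv));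
    rewrite -/a.
  rewrite -lerBlDr [a / gamma * _]mulrAC ler_pdivlMr//.
  have := mulr_ge0 a0 (sqr_ge0 (Lip z - gamma / 4)); lra.
rewrite RintegralD// RintegralZl// Rintegral_prob_cst.
have L2 : \int[mu]_z Lip z ^+ 2 <= gamma * gamma / 16.
  by apply: (le_trans Lip2_le); nra.
have aL : a / gamma * \int[mu]_z Lip z ^+ 2 <= a / gamma * (gamma * gamma / 16).
  by rewrite ler_wpM2l// divr_ge0// ltW.
have aE : a / gamma * (gamma * gamma / 16) = gamma / 16 * a by field;
  rewrite gt_eqF.
by rewrite aE in aL; lra.
Qed.
End oracle.

(** * The history of the draws *)

Section history.
Context (R : realType) (dXi : measure_display) (Xi : measurableType dXi).
Context (mu : probability Xi R).
Context (dO : measure_display) (Omega : measurableType dO)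
  (P : probability Omega R).
Context (xi : nat -> nat -> Omega -> Xi) (rk : Omega -> nat) (m : nat -> nat)
  (k : nat).
Hypothesis xi_measurable : forall t i, (1 <= t <= k)%N -> (i < m t)%N ->
  measurable_fun [set: Omega] (xi t i).
Hypothesis xi_law : forall t i, (1 <= t <= k)%N -> (i < m t)%N ->
  forall A : set Xi, measurable A -> P (xi t i @^-1` A) = mu A.
Hypothesis rk_measurable : measurable_fun [set: Omega] rk.
Hypothesis independence : mutually_independent P (used_draws m k) (draws xi rk).

(** The draws that precede draw i of iteration t in lexicographic order. *)
Definition past (t i : nat) : set (option (nat * nat)) :=
  [set j | if j is Some (t', i') then
     [/\ (1 <= t' <= k)%N, (i' < m t')%N & (t' < t)%N \/ t' = t /\ (i' < i)%N]
   else False].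

Definition history (t i : nat) : set (set Omega) :=
  \bigcup_(j in past t i) draws xi rk j.

Lemma past_used t i : past t i `<=` used_draws m k.
Proof. by case=> [[t' i']|] // []. Qed.

Lemma draws_measurable j : used_draws m k j -> draws xi rk j `<=` measurable.
Proof.
case: j => [[t i]|] /= => [[tk im]|_] _ [B mB <-]; first exact: xi_measurable.
exact: rk_measurable.
Qed.

Lemma draws_setT j : used_draws m k j -> draws xi rk j setT.
Proof.
by case: j => [[t i]|] /= _; exists setT => //; rewrite preimage_setT setIT.
Qed.

Lemma draws_setI j : used_draws m k j -> setI_closed (draws xi rk j).
Proof.
case: j => [[t i]|] /= _ _ _ [A mA <-] [B mB <-]; exists (A `&` B);
  by [exact: measurableI|rewrite !setTI preimage_setI].
Qed.

Lemma history_measurable t i : history t i `<=` measurable.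
Proof. by move=> A [j /past_used uj]; exact: draws_measurable. Qed.

Lemma historyS t i : history t i `<=` history t i.+1.
Proof.
apply: bigcup_subset => -[[t' i']|] //= [tk im [tt|[tt ii]]]; split=> //;
  [by left|right].
by split=> //; rewrite ltnW.
Qed.

Lemma history_next t t' i : (t < t')%N -> history t i `<=` history t' 0.
Proof.
move=> tt; apply: bigcup_subset => -[[s j]|] //= [sk jm st]; split=> //; left.
by case: st => [/ltn_trans|[->]] //; exact.
Qed.

Lemma history_le t t' : (t <= t')%N -> history t 0 `<=` history t' 0.
Proof. by rewrite leq_eqVlt => /predU1P[->//|]; exact: history_next. Qed.

Lemma fresh_draw t i : (1 <= t <= k)%N -> (i < m t)%N -> fresh P mu
  (history t i) (xi t i).
Proof.
move=> tk im; split; first exact: xi_measurable.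
move=> A B hA mB; rewrite -(xi_law tk im mB).
apply: (@independent_of_group _ _ _ P _ _ (draws xi rk) draws_measurable
  draws_setT
  draws_setI independence (past t i) (Some (t, i))) => //.
- exact: past_used.
- by move=> /= [_ _ [|[_]]]; rewrite ltnn.
- by exists B => //; rewrite setTI.
Qed.

Lemma draw_adapted t i : (1 <= t <= k)%N -> (i < m t)%N ->
  adapted (history t i.+1) (xi t i).
Proof.
move=> tk im _ B mB; rewrite /measurable/=; apply: sub_sigma_algebra.
by exists (Some (t, i)) => /=; [split=> //; right|exists B].
Qed.

Lemma output_independent t i A B : <<s history t i >> A ->
  P (A `&` rk @^-1` B) = (P A * P (rk @^-1` B))%E.
Proof.
move=> hA.
apply: (@independent_of_group _ _ _ P _ _ (draws xi rk) draws_measurable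
  draws_setT
  draws_setI independence (past t i) None) => //.
- exact: past_used.
- by exists B => //; rewrite setTI.
Qed.
End history.

(** On each event rk = t the integrand is g t, which is independent of that
    event. *)
Lemma ge0_integral_random_time d (Omega : measurableType d) (R : realType)
    (P : probability Omega R) (G : set (set Omega)) (rk : Omega -> nat)
    (k : nat) (g : nat -> Omega -> R) :
  G `<=` measurable -> measurable_fun [set: Omega] rk ->
  (forall w, (rk w < k)%N) ->
  (forall A B, <<s G >> A -> P (A `&` rk @^-1` B) = (P A * P (rk @^-1` B))%E) ->
  (forall t, (t < k)%N -> adapted G (g t)) -> (forall t w, 0 <= g t w) ->
  (\int[P]_w (g (rk w) w)%:E =
   \sum_(t < k) P [set w | rk w = t] * \int[P]_w (g t w)%:E)%E.
Proof.
move=> mG mrk rkk indep ag g0.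
have mrkt t : measurable [set w | rk w = t].
  by have := mrk measurableT [set t] I; rewrite setTI.
have gE w : (g (rk w) w)%:E = (\sum_(t < k) (g t w * \1_[set w | rk w = t]
  w)%:E)%E.
  rewrite (bigD1 (Ordinal (rkk w)))//= indicE mem_set// mulr1 big1 ?adde0// => t
    trk.
  rewrite indicE memNset ?mulr0// => /= rkt; move: trk.
  by rewrite -(inj_eq val_inj)/= -rkt eqxx.
under eq_integral do rewrite gE.
have mgt (t : 'I_k) : measurable_fun [set: Omega]
  (fun w => (g t w * \1_[set w | rk w = t] w)%:E).
  apply/measurable_EFinP/measurable_funM; last exact: measurable_indic.
  by apply: adapted_measurable mG _; exact: ag.
rewrite ge0_integral_sum//; last first.
  by move=> t w _; rewrite lee_fin mulr_ge0.
apply: eq_bigr => t _.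
pose rkM : {mfun Omega >-> nat} := HB.pack rk (isMeasurableFun.Build _ _ _ _ rk
  mrk).
have := @ge0_integral_fresh _ _ _ P _ _ _ _ (distribution P rkM) _ _
  (id_adapted mG) mrk
  (fun A B mA mB => indep A B mA)
  (fun p => (g t p.1 * \1_[set (t : nat)] p.2)%:E).
rewrite (_ : (fun w => _) = fun w => (g t w * \1_[set w | rk w = t] w)%:E)//.
move=> ->; last 2 first.
- apply/measurable_EFinP/measurable_funM.
    by apply: measurableT_comp measurable_fst; exact: ag.
  exact: measurableT_comp (measurable_indic _) measurable_snd.
- by move=> p; rewrite lee_fin mulr_ge0.
rewrite muleC -ge0_integralZr//; last 2 first.
- by apply/measurable_EFinP; apply: adapted_measurable mG _; exact: ag.
- by move=> w _; rewrite lee_fin.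
apply: eq_integral => w _ /=.
under eq_integral do rewrite EFinM.
by rewrite ge0_integralZl ?lee_fin// integral_indic// setIT.
Qed.

(** * Batch sizes *)

Lemma ceil_divn_ge (a c : nat) : (0 < c)%N ->
  (a <= `|Num.ceil (a%:R / c%:R : rat)|%N * c)%N.
Proof.
move=> c0; have c0' : 0 < c%:R :> rat by rewrite ltr0n.
rewrite -(ler_nat rat) natrM -ler_pdivrMr//.
apply: (le_trans (ceil_ge _)); rewrite natr_absz ger0_norm//.
by rewrite ceil_ge0 (lt_le_trans (ltrN10 _))// divr_ge0.
Qed.

Lemma small_batch_first T t : epoch_pos T t <> 1%N -> epoch T t = 1%N ->
  (T ^ 2 <= small_batch T t * (epoch_pos T t).-1)%N.
Proof.
move=> pt et; rewrite /small_batch et eqxx; apply: ceil_divn_ge.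
by move: pt; rewrite /epoch_pos; case: (_ %% _)%N.
Qed.

Lemma small_batch_later T t : epoch T t <> 1%N -> (13 * T <= 2 * small_batch T
  t)%N.
Proof.
move=> /eqP et; rewrite /small_batch (negbTE et) [leqRHS]mulnC.
exact: (@ceil_divn_ge (13 * T) 2).
Qed.

Lemma small_batch_gt0 T t : (0 < T)%N -> epoch_pos T t <> 1%N ->
  (0 < small_batch T t)%N.
Proof.
move=> T0 pt; case: (eqVneq (epoch T t) 1%N) => [et|/eqP et].
  have := small_batch_first pt et; case: (small_batch T t) => //.
  by rewrite mul0n leqn0 expn_eq0 (gtn_eqF T0).
by have := small_batch_later et; case: (small_batch T t) => //;
  rewrite muln0 leqn0 muln_eq0 (gtn_eqF T0).
Qed.

(** * The run of the method *)

Section run.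
Context (R : realType) (n : nat).
Context (X : set 'rV[R]_n) (f : 'rV[R]_n -> R) (gradf : 'rV[R]_n -> 'rV[R]_n).
Context (L : R).
Context (dXi : measure_display) (Xi : measurableType dXi)
  (mu : probability Xi R).
Context (F : 'rV[R]_n -> Xi -> R) (G : 'rV[R]_n -> Xi -> 'rV[R]_n).
Context (Lip : Xi -> R) (Lhat Lbar sigma : R).
Context (dO : measure_display) (Omega : measurableType dO)
  (P : probability Omega R).
Context (T N k : nat) (gamma : R) (x0 : 'rV[R]_n).
Context (xi : nat -> nat -> Omega -> Xi) (x Gt : nat -> Omega -> 'rV[R]_n).
Context (rk : Omega -> nat).
Hypotheses (X_nonempty : X !=set0) (X_convex : convex_set X)
  (X_compact : compact X).
Hypothesis gradf_lipschitz : forall u v, X u -> X v ->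
  enorm (gradf u - gradf v) <= L * enorm (u - v).
Hypothesis L_ge0 : 0 <= L.
Hypothesis oracle : stochastic_oracle X f gradf mu F G Lip Lhat Lbar sigma.
Hypotheses (T_gt0 : (0 < T)%N) (N_gt0 : (0 < N)%N).
Hypotheses (gamma_gt0 : 0 < gamma) (x0_in_X : X x0).
Let nb := nb_samples T N (small_batch T).
Hypothesis xi_measurable : forall t i, (1 <= t <= k)%N -> (i < nb t)%N ->
  measurable_fun [set: Omega] (xi t i).
Hypothesis xi_law : forall t i, (1 <= t <= k)%N -> (i < nb t)%N ->
  forall A : set Xi, measurable A -> P (xi t i @^-1` A) = mu A.
Hypothesis method : VR_SPG X G x0 T N k (small_batch T) (fun=> gamma) xi x Gt.
Hypothesis rk_measurable : measurable_fun [set: Omega] rk.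
Hypothesis independence : mutually_independent P (used_draws nb k)
  (draws xi rk).

(** What precedes draw 0 of iteration t + 1 are the draws of the first t
    iterations. *)
Definition known (t : nat) : set (set Omega) := history xi rk nb k t.+1 0.

Definition noise (t : nat) (w : Omega) : 'rV[R]_n := Gt t w - gradf (x t.-1 w).

Lemma known_measurable t : known t `<=` measurable.
Proof. exact: history_measurable. Qed.

Lemma knownS t : known t `<=` known t.+1.
Proof. exact: history_next. Qed.

Lemma known_next t i : history xi rk nb k t.+1 i `<=` known t.+1.
Proof. exact: history_next. Qed.

Lemma vadapted_gradf (A : set (set Omega)) (y : Omega -> 'rV[R]_n) :
  vadapted A y -> (forall w, X (y w)) -> vadapted A (fun w => gradf (y w)).
Proof.
move=> ay Xy i.
have H := @measurable_lipschitz_on _ _ _ X_nonempty X_convex X_compact _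
  (g_sigma_algebraType A) _ (g_sigma_algebraType A)
  (fun u _ => gradf u 0 i) (fun=> L) y id.
apply: H => //.
move=> u v _ Xu Xv; apply: le_trans (gradf_lipschitz Xu Xv).
by apply: le_trans (coord_le_enorm _ i); rewrite !mxE.
Qed.

Lemma jointly_measurable_noise (A : set (set Omega)) (y : Omega -> 'rV[R]_n) i :
  vadapted A y -> (forall w, X (y w)) ->
  jointly_measurable A (fun w z => (G (y w) z - gradf (y w)) 0 i).
Proof.
move=> ay Xy.
have ay1 j : measurable_fun [set: g_sigma_algebraType A * Xi]
  (fun p => y p.1 0 j).
  exact: measurableT_comp (ay j) measurable_fst.
have m1 : measurable_fun [set: g_sigma_algebraType A * Xi]
  (fun p => G (y p.1) p.2 0 i).
  have H := @measurable_lipschitz_on _ _ _ X_nonempty X_convex X_compact _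
    (g_sigma_algebraType A * Xi)%type _ Xi
    (fun u z => G u z 0 i) Lip (fun p => y p.1) snd.
  apply: H => //.
  - exact: oracle_Lip_ge0 oracle.
  - move=> u v z Xu Xv; apply: le_trans (oracle_lipschitz oracle z Xu Xv).
    by apply: le_trans (coord_le_enorm _ i); rewrite !mxE.
  - by move=> u Xu; have /integrableP[/measurable_EFinP]
    := oracle_grad_integrable oracle i Xu.
  have m2 : measurable_fun [set: g_sigma_algebraType A * Xi]
    (fun p => gradf (y p.1) 0 i).
  exact: measurableT_comp (vadapted_gradf ay Xy i) measurable_fst.
have := measurable_funB m1 m2.
by congr (measurable_fun _ _); apply/funext => p; rewrite !mxE.
Qed.

Lemma vsquare_integrable_diff t (y z : Omega -> 'rV[R]_n) :
  vadapted (known t) y -> vadapted (known t) z ->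
  (forall w, X (y w)) -> (forall w, X (z w)) ->
  vsquare_integrable P (fun w => y w - z w).
Proof.
move=> ay az Xy Xz i; apply: (@square_integrable_bounded _ _ _ _ _ `|diameter
  X|).
  exact: adapted_measurable (@known_measurable t) (vadaptedB ay az i).
move=> w; apply: le_trans (coord_le_enorm _ i) _.
by rewrite -[leRHS]sqrtr_sqr ler_wsqrtr// diameter_ub.
Qed.

Section one_iteration.
Variable t : nat.
Hypothesis t_lt_k : (t < k)%N.
Hypothesis X_t : forall w, X (x t w).
Hypothesis x_t : vadapted (known t) (x t).

Let tk : (1 <= t.+1 <= k)%N. Proof. exact: t_lt_k. Qed.

(** A minibatch started at 0. *)
Lemma noise_restart : epoch_pos T t.+1 = 1%N ->
  [/\ vadapted (known t.+1) (noise t.+1), vsquare_integrable P (noise t.+1),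
      \int[P]_w dotv (noise t.+1 w) (noise t.+1 w) <= sigma ^+ 2 / N%:R
    & forall V, vadapted (known t) V -> vsquare_integrable P V ->
      \int[P]_w dotv (noise t.+1 w) (V w) = 0].
Proof.
move=> pt; have nbN : nb t.+1 = N by rewrite /nb /nb_samples pt eqxx.
have N0 : N%:R != 0 :> R by rewrite pnatr_eq0 -lt0n.
have noiseE w : noise t.+1 w = 0 + N%:R^-1 *:
    \sum_(j < N) (G (x t w) (xi t.+1 j w) - gradf (x t w)).
  rewrite /noise (VR_SPG_restart method w tk pt) add0r /=.
  rewrite sumrB.
  have -> : \sum_(j < N) gradf (x t w) = N%:R *: gradf (x t w).
    by rewrite sumr_const card_ord scaler_nat.
  by rewrite scalerBr scalerA mulVf// scale1r.
have s0 : vsquare_integrable P (fun=> 0 : 'rV[R]_n).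
  by move=> i; apply: (@square_integrable_bounded _ _ _ _ _ 0) => // w;
    rewrite mxE normr0.
have := @vector_batch_moments _ _ _ P n _ _ mu (history xi rk nb k t.+1)
  (xi t.+1) N
  (fun w z => G (x t w) z - gradf (x t w)) (fun=> 0) (N%:R^-1)
    (fun=> sigma ^+ 2) (noise t.+1).
case => //.
- by move=> i; exact: history_measurable.
- by move=> i; exact: historyS.
- by move=> i iN; apply: fresh_draw => //; rewrite nbN.
- by move=> i iN; apply: draw_adapted => //; rewrite nbN.
- by move=> i; exact: jointly_measurable_noise.
- by move=> w i; exact: (oracle_noise_integrable oracle i (X_t w)).
- by move=> w i; exact: (oracle_noise_mean oracle i (X_t w)).
- exact: integrable_fun_cst.
- by move=> w; exact: (oracle_noise_variance oracle (X_t w)).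
- exact: vadapted_cst.
move=> aN sN N2 NV; split=> //.
- exact: vadaptedS (@known_next t N) aN.
- apply: (le_trans N2); rewrite !Rintegral_prob_cst dotv0l add0r expr2 mulrA
  divff// mul1r mulrC.
  exact: lexx.
- move=> V aV sV; rewrite NV//.
  by under eq_Rintegral do rewrite dotv0l; rewrite Rintegral_prob_cst.
Qed.

Hypothesis X_t1 : forall w, X (x t.-1 w).
Hypothesis x_t1 : vadapted (known t) (x t.-1).
Hypothesis noise_adapted : vadapted (known t) (noise t).
Hypothesis noise_square_integrable : vsquare_integrable P (noise t).

(** A minibatch started at the previous error: the centring terms of its
    increments average to the difference of the gradients at the last two
    iterates. *)
Lemma noise_recursion : epoch_pos T t.+1 <> 1%N ->
  [/\ vadapted (known t.+1) (noise t.+1), vsquare_integrable P (noise t.+1),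
      \int[P]_w dotv (noise t.+1 w) (noise t.+1 w)
        <= \int[P]_w dotv (noise t w) (noise t w) +
           Lbar ^+ 2 / (small_batch T t.+1)%:R
             * \int[P]_w dotv (x t w - x t.-1 w) (x t w - x t.-1 w)
    & forall V, vadapted (known t) V -> vsquare_integrable P V ->
      \int[P]_w dotv (noise t.+1 w) (V w) = \int[P]_w dotv (noise t w) (V w)].
Proof.
move=> pt; set b := small_batch T t.+1.
have nbE : nb t.+1 = b by rewrite /nb /nb_samples; case: eqP pt.
have b0 : b%:R != 0 :> R by rewrite pnatr_eq0 -lt0n small_batch_gt0.
have noiseE w : noise t.+1 w = noise t w + b%:R^-1 *:
    \sum_(j < b) (G (x t w) (xi t.+1 j w) - gradf (x t w)
                  - (G (x t.-1 w) (xi t.+1 j w) - gradf (x t.-1 w))).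
  rewrite /noise (VR_SPG_recursion method w tk pt) /= -/b.
  have -> : \sum_(j < b) (G (x t w) (xi t.+1 j w) - gradf (x t w)
                  - (G (x t.-1 w) (xi t.+1 j w) - gradf (x t.-1 w))) =
      \sum_(j < b) (G (x t w) (xi t.+1 j w) - G (x t.-1 w) (xi t.+1 j w))
      - b%:R *: (gradf (x t w) - gradf (x t.-1 w)).
    have -> : b%:R *: (gradf (x t w) - gradf (x t.-1 w)) =
        \sum_(j < b) (gradf (x t w) - gradf (x t.-1 w)).
      by rewrite sumr_const card_ord scaler_nat.
    rewrite -sumrB; apply: eq_bigr => j _.
    by apply/rowP => i; rewrite !mxE; ring.
  rewrite scalerBr scalerA mulVf// scale1r.
  by apply/rowP => i; rewrite !mxE; ring.
have s_diff := vsquare_integrable_diff x_t x_t1 X_t X_t1.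
have := @vector_batch_moments _ _ _ P n _ _ mu (history xi rk nb k t.+1)
  (xi t.+1) b
  (fun w z => G (x t w) z - gradf (x t w) - (G (x t.-1 w) z - gradf (x t.-1 w)))
  (noise t) (b%:R^-1) (fun w => Lbar ^+ 2 * dotv (x t w - x t.-1 w)
    (x t w - x t.-1 w))
  (noise t.+1).
case => //.
- by move=> i; exact: history_measurable.
- by move=> i; exact: historyS.
- by move=> i ib; apply: fresh_draw => //; rewrite nbE.
- by move=> i ib; apply: draw_adapted => //; rewrite nbE.
- move=> i; have m := measurable_funB (jointly_measurable_noise i x_t X_t)
    (jointly_measurable_noise i x_t1 X_t1).
  by apply: eq_measurable_fun m => p _; rewrite /= !mxE.
- move=> w i; have := integrableB measurableT (oracle_noise_integrable oracle i
  (X_t w))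
    (oracle_noise_integrable oracle i (X_t1 w)).
  by congr (_.-integrable _ _); apply/funext => z; rewrite !mxE EFinB.
- move=> w i; pose u z := G (x t w) z - gradf (x t w).
  pose v z := G (x t.-1 w) z - gradf (x t.-1 w).
  have iu : mu.-integrable [set: Xi] (fun z => (u z 0 i)%:E).
    exact: (oracle_noise_integrable oracle i (X_t w)).
  have iv : mu.-integrable [set: Xi] (fun z => (v z 0 i)%:E).
    exact: (oracle_noise_integrable oracle i (X_t1 w)).
  transitivity (\int[mu]_z ((u z 0 i)%:E - (v z 0 i)%:E))%E.
    by apply: eq_integral => z _; rewrite -EFinB /u /v !mxE.
  by rewrite integralB// !(oracle_noise_mean oracle)// sube0.
- by apply: integrable_funZ; exact: integrable_dotv.
- by move=> w; exact: (oracle_difference_variance oracle (X_t w) (X_t1 w)).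
move=> aN sN N2 NV; split=> //.
  exact: vadaptedS (@known_next t b) aN.
apply: (le_trans N2); rewrite lerD2l RintegralZl//; last exact: integrable_dotv.
rewrite mulrA ler_wpM2r//; last first.
  by rewrite expr2 mulrA divff// mul1r mulrC.
by apply: Rintegral_ge0 => w _; exact: dotvv_ge0.
Qed.
End one_iteration.

(** Measurability passes from x t to noise t.+1, to Gt t.+1 and to x t.+1;
    the recursion looks two iterates back, hence the strong induction. *)
Lemma run_state t : (t <= k)%N ->
  [/\ forall w, X (x t w), vadapted (known t) (x t)
    & (0 < t)%N -> vadapted (known t) (noise t) /\ vsquare_integrable P
      (noise t)].
Proof.
suff : (t <= k)%N -> forall s, (s <= t)%N ->
    [/\ forall w, X (x s w), vadapted (known s) (x s)
    & (0 < s)%N -> vadapted (known s) (noise s) /\ vsquare_integrable P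
      (noise s)].
  by move=> H tk; exact: H.
elim: t => [_ s|t IH tk s].
  rewrite leqn0 => /eqP ->; split=> // [w|].
    by rewrite (VR_SPG_init method).
  rewrite (_ : x 0%N = fun=> x0); first exact: vadapted_cst.
  by apply/funext => w; rewrite (VR_SPG_init method).
rewrite leq_eqVlt => /predU1P[->|]; last by rewrite ltnS; apply: IH (ltnW tk) s.
have [X_t x_t noise_t] := IH (ltnW tk) t (leqnn t).
have [X_t1 x_t1 _] := IH (ltnW tk) t.-1 (leq_pred t).
have {}x_t1 : vadapted (known t) (x t.-1).
  by case: t x_t1 {IH tk X_t x_t noise_t X_t1} => // t;
    exact: vadaptedS (@knownS t).
have [aN sN] : vadapted (known t.+1) (noise t.+1) /\ vsquare_integrable P
  (noise t.+1).
  have [pt|/eqP pt] := eqVneq (epoch_pos T t.+1) 1%N.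
    by have [] := noise_restart tk X_t x_t pt.
  have t0 : (0 < t)%N by case: t pt {IH tk X_t x_t noise_t X_t1 x_t1} => //;
    rewrite /epoch_pos mod0n.
  have [aN sN] := noise_t t0.
  by have [] := noise_recursion tk X_t x_t X_t1 x_t1 aN sN pt.
have x_tS : vadapted (known t.+1) (x t) by exact: vadaptedS (@knownS t) x_t.
have xE w : x t.+1 w = prox_step X (x t w) (Gt t.+1 w) gamma.
  exact: (VR_SPG_step method (t := t.+1) w tk).
split=> [w||_] //.
  by rewrite xE; have [] := prox_stepP X_nonempty X_convex X_compact (x t w)
    (Gt t.+1 w) gamma_gt0.
have aG : vadapted (known t.+1) (Gt t.+1).
  have := vadaptedD aN (vadapted_gradf x_tS X_t).
  by congr vadapted; apply/funext => w; rewrite /noise subrK.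
rewrite (_ : x t.+1 = fun w => prox_step X (x t w) (Gt t.+1 w) gamma);
  last exact/funext.
exact: (@measurable_prox_step _ _ _ X_nonempty X_convex X_compact _
  (g_sigma_algebraType (known t.+1))).
Qed.

Hypotheses (gradf_C1 : C1_on X f gradf) (T_le_k : (T <= k)%N).
Variable l : R.
Hypothesis l_ge0 : 0 <= l.
Hypothesis f_lower_curvature : forall u v, X u -> X v ->
  - (l / 2) * enorm (u - v) ^+ 2 <= f u - f v - dotv (gradf v) (u - v).
Hypotheses (Lbar_ge0 : 0 <= Lbar) (gamma_ge : 4 * Lbar <= gamma).
Hypothesis rk_lt_k : forall w, (rk w < k)%N.
Hypothesis rk_law : forall t, (1 <= t <= k)%N ->
  P [set w | rk w = t.-1] = (t%:R * (\sum_(1 <= j < k.+1) j%:R)^-1 : R)%:E.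

Let D2 : R := diameter X ^+ 2.
Let move2 t := \int[P]_w dotv (x t w - x t.-1 w) (x t w - x t.-1 w).
Let noise2 t := \int[P]_w dotv (noise t w) (noise t w).
Let cross t := \int[P]_w dotv (noise t w) (x t.-1 w - x t w).
Let grad2 t := \int[P]_w enorm (g_X X gradf (fun=> gamma) x t w) ^+ 2.

Let state t : (t <= k)%N -> (forall w, X (x t w)) /\ vadapted (known t) (x t).
Proof. by move=> /run_state[]. Qed.

Let state_pred t : (t <= k)%N -> vadapted (known t) (x t.-1).
Proof.
case: t => [|t] tk; first by have [] := state tk.
by apply: vadaptedS (@knownS t) _; have [] := state (ltnW tk).
Qed.

Let X_x t w : (t <= k)%N -> X (x t w).
Proof. by move=> /state[]. Qed.

Let X_pred t w : (t <= k)%N -> X (x t.-1 w).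
Proof. by move=> tk; apply: X_x; exact: leq_trans (leq_pred t) tk. Qed.

Let noise_si t : (1 <= t <= k)%N -> vsquare_integrable P (noise t).
Proof. by move=> /andP[t0 tk]; have [_ _ /(_ t0)[]] := run_state tk. Qed.

Let move_si t : (t <= k)%N -> vsquare_integrable P (fun w => x t w - x t.-1 w).
Proof.
move=> tk; apply: (@vsquare_integrable_diff t);
  [by have [] := state tk|exact: state_pred| |].
  by move=> w; exact: X_x.
by move=> w; exact: X_pred.
Qed.

Let back_si t : (t <= k)%N -> vsquare_integrable P (fun w => x t.-1 w - x t w).
Proof.
move=> tk; apply: (@vsquare_integrable_diff t);
  [exact: state_pred|by have [] := state tk| |].
  by move=> w; exact: X_pred.
by move=> w; exact: X_x.
Qed.

Let target_adapted u t : (t <= k)%N -> vadapted (known t) (fun w => u - x t w).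
Proof. by move=> tk; apply: vadaptedB;
  [exact: vadapted_cst|have [] := state tk]. Qed.

Let target_si u t : X u -> (t <= k)%N -> vsquare_integrable P
  (fun w => u - x t w).
Proof.
move=> Xu tk; apply: (@vsquare_integrable_diff t) => //;
  first exact: vadapted_cst.
  by have [] := state tk.
by move=> w; exact: X_x.
Qed.

Let le_Rint (Y Z : Omega -> R) : integrable_fun P Y -> integrable_fun P Z ->
  (forall w, Y w <= Z w) -> \int[P]_w Y w <= \int[P]_w Z w.
Proof. by move=> iY iZ YZ; apply: le_Rintegral. Qed.

Let expected_young (U V : Omega -> 'rV[R]_n) (c : R) : 0 < c ->
  vsquare_integrable P U -> vsquare_integrable P V ->
  \int[P]_w dotv (U w) (V w) <=
    c / 2 * \int[P]_w dotv (V w) (V w) + \int[P]_w dotv (U w) (U w) / (2 * c).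
Proof.
move=> c0 sU sV; have iU := integrable_dotv sU sU; have iV := integrable_dotv sV
  sV.
have -> : \int[P]_w dotv (U w) (U w) / (2 * c) = (2 * c)^-1 * \int[P]_w dotv
  (U w) (U w).
  by rewrite mulrC.
rewrite -!RintegralZl// -RintegralD//;
  [|exact: integrable_funZ|exact: integrable_funZ].
apply: le_Rint; first exact: integrable_dotv.
  by apply: integrable_funD; exact: integrable_funZ.
by move=> w; rewrite [_^-1 * _]mulrC; exact: dotv_young.
Qed.

Lemma expected_run_bound u : X u -> (forall v, X v -> f u <= f v) ->
  \sum_(1 <= t < k.+1) ((7 / 8 * t%:R - 1 / 2) * (gamma * move2 t)
     - t%:R * cross t - \int[P]_w dotv (noise t w) (u - x t.-1 w))
  <= gamma / 2 * D2 + l * k%:R / 2 * D2.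
Proof.
move=> Xu umin.
pose Y (i : 'I_k) w := (7 / 8 * i.+1%:R - 1 / 2) *
  (gamma * dotv (x i.+1 w - x i w) (x i.+1 w - x i w))
     + (- i.+1%:R) * dotv (noise i.+1 w) (x i w - x i.+1 w)
     + (- 1) * dotv (noise i.+1 w) (u - x i w).
have ik (i : 'I_k) : (1 <= i.+1 <= k)%N by rewrite /= ltn_ord.
have i1 (i : 'I_k) := integrable_dotv (move_si (ltn_ord i))
  (move_si (ltn_ord i)).
have i2 (i : 'I_k) := integrable_dotv (noise_si (ik i)) (back_si (ltn_ord i)).
have i3 (i : 'I_k) := integrable_dotv (noise_si (ik i))
  (target_si Xu (ltnW (ltn_ord i))).
have iY1 (i : 'I_k) : integrable_fun P (fun w => (7 / 8 * i.+1%:R - 1 / 2) *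
    (gamma * dotv (x i.+1 w - x i w) (x i.+1 w - x i w))).
  exact: (integrable_funZ _ (integrable_funZ _ (i1 i))).
have iY2 i := integrable_funD (iY1 i) (integrable_funZ (- i.+1%:R) (i2 i)).
have iY i : integrable_fun P (Y i).
  exact: (integrable_funD (iY2 i) (integrable_funZ (-1) (i3 i))).
have EY i : \int[P]_w Y i w = (7 / 8 * i.+1%:R - 1 / 2) * (gamma * move2 i.+1)
     - i.+1%:R * cross i.+1 - \int[P]_w dotv (noise i.+1 w) (u - x i w).
  rewrite RintegralD//; [|exact: iY2|exact: (integrable_funZ (-1) (i3 i))].
  rewrite RintegralD//; [|exact: iY1|exact: (integrable_funZ _ (i2 i))].
  rewrite RintegralZl//; last exact: (integrable_funZ _ (i1 i)).
  rewrite RintegralZl//; last exact: (i1 i).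
  rewrite RintegralZl//; last exact: (i2 i).
  rewrite RintegralZl//; last exact: (i3 i).
  by rewrite mulNr mulN1r.
rewrite big_add1 big_mkord.
under eq_bigr do rewrite -EY.
rewrite -Rintegral_fun_sum// -[leRHS](Rintegral_prob_cst P).
apply: le_Rint; [exact: integrable_fun_sum|exact: integrable_fun_cst|move=> w].
have upper a b : X a -> X b -> f a - f b - dotv (gradf b) (a - b) <= gamma / 8 *
  enorm (a - b) ^+ 2.
  by move=> Xa Xb; exact: (oracle_smoothness oracle).
have := @run_bound _ _ _ X_nonempty X_convex X_compact _ _ _ _ l_ge0 gamma_gt0
  f_lower_curvature upper (fun t => x t w) (fun t => Gt t w) u k _ Xu umin.
rewrite (VR_SPG_init method) => /(_ x0_in_X) H.
apply: le_trans (H _) => [|t tk]; last exact: (VR_SPG_step method).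
rewrite big_add1 big_mkord le_eqVlt; apply/orP; left; apply/eqP.
by apply: eq_bigr => i _; rewrite /Y mulNr mulN1r.
Qed.

(** The gradient mapping at x_(t-1) and the step actually made differ by the
    effect of the error on the projection, which is at most |delta_t| /
    gamma. *)
Lemma expected_gradient_step t : (1 <= t <= k)%N ->
  adapted (known t) (fun w => enorm (g_X X gradf (fun=> gamma) x t.-1 w) ^+ 2)
  /\ (\int[P]_w (enorm (g_X X gradf (fun=> gamma) x t.-1 w) ^+ 2)%:E
    = (grad2 t.-1)%:E)%E
  /\ grad2 t.-1 <= 2 * gamma ^+ 2 * move2 t + 2 * noise2 t.
Proof.
move=> /andP[t0 tk].
pose g w := g_X X gradf (fun=> gamma) x t.-1 w.
have ag : vadapted (known t) g.
  apply: vadaptedZ; apply: vadaptedB; first exact: state_pred.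
  apply: (@measurable_prox_step _ _ _ X_nonempty X_convex X_compact _
    (g_sigma_algebraType (known t))) => //.
    exact: state_pred.
  by apply: vadapted_gradf => [|w]; [exact: state_pred|exact: X_pred].
have ag2 : adapted (known t) (fun w => enorm (g w) ^+ 2).
  under eq_fun do rewrite enorm_sqr.
  by apply: measurable_sum => i; apply: measurable_funM; exact: ag.
have g_le w : enorm (g w) ^+ 2 <= 2 * gamma ^+ 2 * dotv (x t w - x t.-1 w)
  (x t w - x t.-1 w)
    + 2 * dotv (noise t w) (noise t w).
  have := prox_step_dist X_nonempty X_convex X_compact (x t.-1 w)
    (gradf (x t.-1 w))
    (x t.-1 w) (Gt t w) gamma_gt0.
  have tk' : (1 <= t <= k)%N by rewrite t0.
  rewrite -(VR_SPG_step method w tk') /= enorm_sqr /g /g_X /proj_grad.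
  set p := prox_step _ _ (gradf _) _; set a := x t w; set b := x t.-1 w.
  have -> : gamma *: b - gradf b - (gamma *: b - Gt t w) = noise t w.
    by rewrite /noise -/b; apply/rowP => i; rewrite !mxE; ring.
  have := dotvv_ge0 (gamma *: (p - a) - gamma *: (a - b)).
  have -> : b - p = - ((p - a) + (a - b)) by apply/rowP => i; rewrite !mxE;
    ring.
  move: (p - a) (a - b) (dotv (noise t w) _) => c e nn.
  rewrite !dotvE (dotvC e c); lra.
have ig : integrable_fun P (fun w => enorm (g w) ^+ 2).
  have tk' : (1 <= t <= k)%N by rewrite t0.
  apply: (integrable_fun_le _ (integrable_funD
    (integrable_funZ (2 * gamma ^+ 2) (integrable_dotv (move_si tk)
      (move_si tk)))
    (integrable_funZ 2 (integrable_dotv (noise_si tk') (noise_si tk'))))).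
    exact: adapted_measurable (@known_measurable t) ag2.
  by move=> w; rewrite ger0_norm ?sqr_ge0.
split=> //; split; first by rewrite /grad2 EFin_Rintegral.
have tk' : (1 <= t <= k)%N by rewrite t0.
have i1 := integrable_dotv (move_si tk) (move_si tk).
have i2 := integrable_dotv (noise_si tk') (noise_si tk').
rewrite -!RintegralZl// -RintegralD//;
  [|exact: integrable_funZ|exact: integrable_funZ].
by apply: le_Rint => //; apply: integrable_funD; exact: integrable_funZ.
Qed.

(** The error budget applied to the moments of the run. *)
Lemma weighted_gradient_bound :
  \sum_(1 <= t < k.+1) t%:R / (8 * gamma) * grad2 t.-1
  <= l * k%:R / 2 * D2 + 3 * gamma / 2 * D2
     + 21 * (k%:R + 1) * k%:R * sigma ^+ 2 / (8 * gamma * N%:R).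
Proof.
have [u Xu umin] := exists_minimizer X_nonempty X_compact gradf_C1.
pose q t := \int[P]_w dotv (noise t w) (u - x t.-1 w).
pose W t := gamma * move2 t; pose D t := noise2 t / gamma.
pose S := sigma ^+ 2 / (gamma * N%:R); pose C := gamma * D2.
have N0 : 0 < N%:R :> R by rewrite ltr0n.
have T0 : 0 < T%:R :> R by rewrite ltr0n.
have S0 : 0 <= S by rewrite divr_ge0 ?sqr_ge0// mulr_ge0// ltW.
have C0 : 0 <= C by rewrite mulr_ge0 ?sqr_ge0// ltW.
have W0 t : 0 <= W t.
  by rewrite mulr_ge0 ?(ltW gamma_gt0)//; apply: Rintegral_ge0 => w _;
    exact: dotvv_ge0.
have D0 t : 0 <= D t.
  by rewrite divr_ge0 ?(ltW gamma_gt0)//; apply: Rintegral_ge0 => w _;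
    exact: dotvv_ge0.
have restart t : (1 <= t <= k)%N -> epoch_pos T t = 1%N -> q t = 0 /\ D t <= S.
  case: t => // t tk pt; have [X_t x_t] := state (ltnW tk).
  have [_ _ N2 NV] := noise_restart tk X_t x_t pt.
  split; first by apply: NV; [exact: target_adapted (ltnW tk)|exact: target_si
    (ltnW tk)].
  by rewrite /D /S ler_pdivrMr// invfM mulrA mulrAC divfK ?gt_eqF.
have recursion t : (1 <= t <= k)%N -> epoch_pos T t <> 1%N ->
    q t = q t.-1 + cross t.-1 /\ D t <= D t.-1 + W t.-1 /
      (16 * (small_batch T t)%:R).
  case: t => // t tk pt; have [X_t x_t] := state (ltnW tk).
  have t0 : (0 < t)%N by case: t pt {tk X_t x_t} => //;
    rewrite /epoch_pos mod0n.
  have tk' : (1 <= t <= k)%N by rewrite t0 ltnW.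
  have [_ _ /(_ t0)[aN sN]] := run_state (ltnW tk).
  have X_t1 w := X_pred w (ltnW tk).
  have [_ _ N2 NV] := noise_recursion tk X_t x_t X_t1 (state_pred (ltnW tk)) aN
    sN pt.
  have sq1 : vsquare_integrable P (fun w => u - x t.-1 w).
    by apply: (target_si Xu); exact: leq_trans (leq_pred t) (ltnW tk).
  split.
    rewrite /q NV; [|exact: target_adapted (ltnW tk)|exact: target_si
      (ltnW tk)].
    rewrite -RintegralD//; [|exact: integrable_dotv|exact:
      (integrable_dotv sN (back_si (ltnW tk)))].
    by apply: eq_Rintegral => w _; rewrite -dotvDr addrA subrK.
  have b0 : 0 < (small_batch T t.+1)%:R :> R by rewrite ltr0n small_batch_gt0.
  have LW : Lbar ^+ 2 * move2 t <= gamma ^+ 2 / 16 * move2 t.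
    rewrite ler_wpM2r//; first by apply: Rintegral_ge0 => w _; exact: dotvv_ge0.
    have Lg : Lbar <= gamma / 4 by have := gamma_ge; lra.
    have -> : gamma ^+ 2 / 16 = (gamma / 4) ^+ 2 by field.
    by rewrite lerXn2r ?nnegrE// divr_ge0// ltW.
  rewrite /D ler_pdivrMr// mulrDl divfK ?gt_eqF//; apply: (le_trans N2).
  rewrite lerD2l /W -/(move2 t) mulrAC ler_pdivrMr//.
  have -> : gamma * move2 t / (16 * (small_batch T t.+1)%:R) * gamma *
    (small_batch T t.+1)%:R
      = gamma ^+ 2 / 16 * move2 t by field; rewrite gt_eqF.
  by [].
have p_le t (c : R) : (1 <= t <= k)%N -> 0 < c ->
    cross t <= c / 2 * W t + D t / (2 * c).
  move=> tk c0; have tk' : (t <= k)%N by case/andP: tk.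
  have := @expected_young _ _ (c * gamma) (mulr_gt0 c0 gamma_gt0) (noise_si tk)
    (back_si tk').
  have -> : \int[P]_w dotv (x t.-1 w - x t w) (x t.-1 w - x t w) = move2 t.
    by apply: eq_Rintegral => w _; rewrite -(opprB (x t w)) dotvNl dotvNr opprK.
  rewrite -/(cross t) -/(noise2 t) /W /D => H.
  have -> : noise2 t / gamma / (2 * c) = noise2 t / (2 * (c * gamma)).
    by field; rewrite !gt_eqF.
  by apply: (le_trans H); rewrite lerD2r; lra.
have q_le t : (1 <= t <= k)%N -> q t <= C / T%:R + T%:R / 4 * D t.
  move=> tk; have tk' : (t.-1 <= k)%N by apply: leq_trans (leq_pred t) _;
    case/andP: tk.
  (* the weight that spreads gamma D_X^2 evenly over the first T iterations *)
  have c0 : 0 < 2 * gamma / T%:R by rewrite divr_gt0// mulr_gt0.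
  have := expected_young c0 (noise_si tk) (target_si Xu tk').
  rewrite -/(q t) -/(noise2 t) => H; apply: (le_trans H); apply: lerD.
    have -> : C / T%:R = 2 * gamma / T%:R / 2 * D2 by rewrite /C; field;
      rewrite gt_eqF.
    apply: ler_wpM2l; first by rewrite divr_ge0 ?(ltW c0).
    rewrite -[leRHS](Rintegral_prob_cst P); apply: le_Rint.
    - by apply: integrable_dotv; exact: target_si tk'.
    - exact: integrable_fun_cst.
    - by move=> w; apply: diameter_ub => //; exact: X_x.
  rewrite /D le_eqVlt; apply/orP; left; apply/eqP.
  by field; rewrite !gt_eqF.
have loss_le := total_loss_bound T_gt0 T_le_k C0 S0 W0 D0 restart recursion
  (fun t _ pt et => small_batch_first pt et) (fun t _ _ et => small_batch_later
    et) p_le q_le.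
have run := expected_run_bound Xu umin.
have -> : 21 * (k%:R + 1) * k%:R * sigma ^+ 2 / (8 * gamma * N%:R) =
    21 / 8 * (k%:R * (k%:R + 1)) * S :> R.
  by rewrite /S; field; rewrite !gt_eqF.
have grad : \sum_(1 <= t < k.+1) t%:R / (8 * gamma) * grad2 t.-1 <=
    total_loss W D cross q k +
    \sum_(1 <= t < k.+1) ((7 / 8 * t%:R - 1 / 2) * W t - t%:R * cross t - q t).
  rewrite /total_loss -big_split/= !big_nat; apply: ler_sum => t;
    rewrite ltnS => tk.
  have [_ [_ g2]] := expected_gradient_step tk.
  have t0 : 0 <= t%:R / (8 * gamma) by rewrite divr_ge0 ?mulr_ge0// ltW.
  apply: (le_trans (ler_wpM2l t0 g2)); rewrite /loss /W /D.
  rewrite le_eqVlt; apply/orP; left; apply/eqP.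
  by field; rewrite gt_eqF.
apply: (le_trans grad); apply: (le_trans (lerD loss_le run)).
by rewrite /C; lra.
Qed.

Lemma output_gradient_bound :
  ('E_P [fun w => (enorm (g_X X gradf (fun=> gamma) x (rk w) w) ^+ 2)%R]
     <= ((\sum_(1 <= t < k.+1) (t%:R / (8 * gamma)))^-1
         * (l * k%:R / 2 * diameter X ^+ 2
            + 3 * gamma / 2 * diameter X ^+ 2
            + 21 * (k%:R + 1) * k%:R * sigma ^+ 2 /
              (8 * gamma * N%:R)))%R%:E)%E.
Proof.
pose Sk : R := \sum_(1 <= j < k.+1) j%:R.
have k0 : (0 < k)%N by exact: leq_trans T_le_k.
have Sk0 : 0 < Sk.
  by rewrite /Sk big_nat_recr//= ltr_wpDl ?ltr0n// sumr_ge0.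
have EE : ('E_P [fun w => (enorm (g_X X gradf (fun=> gamma) x (rk w) w) ^+ 2)%R]
  =
    (\sum_(1 <= t < k.+1) t%:R / Sk * grad2 t.-1)%:E)%E.
  rewrite unlock.
  rewrite (@ge0_integral_random_time _ _ _ P (known k) rk k
    (fun t w => enorm (g_X X gradf (fun=> gamma) x t w) ^+ 2)) //.
  - rewrite big_add1 big_mkord -sumEFin; apply: eq_bigr => i _ /=.
    have ik : (1 <= i.+1 <= k)%N by rewrite /= ltn_ord.
    have [_ [-> _]] := expected_gradient_step ik.
    by rewrite (rk_law ik) EFinM.
  - exact: known_measurable.
  - by move=> A B hA; apply: (@output_independent _ _ _ _ _ P xi rk nb k
    xi_measurable rk_measurable independence k.+1 0).
  - move=> t tk; have ik : (1 <= t.+1 <= k)%N by [].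
    have [ag _] := expected_gradient_step ik.
    apply: adaptedS ag; exact: history_le.
  - by move=> t w; exact: sqr_ge0.
rewrite EE lee_fin.
have -> : \sum_(1 <= t < k.+1) t%:R / (8 * gamma) = Sk / (8 * gamma)
  by rewrite /Sk mulr_suml.
have -> : \sum_(1 <= t < k.+1) t%:R / Sk * grad2 t.-1 =
    (Sk / (8 * gamma))^-1 * \sum_(1 <= t < k.+1) t%:R / (8 * gamma) * grad2
      t.-1.
  rewrite mulr_sumr; apply: eq_bigr => t _.
  by field; rewrite !gt_eqF.
rewrite ler_wpM2l ?invr_ge0 ?divr_ge0 ?mulr_ge0 ?(ltW Sk0) ?(ltW gamma_gt0)//.
exact: weighted_gradient_bound.
Qed.
End run.

Lemma sum_natr (R : realType) k : \sum_(1 <= t < k.+1) t%:R = k%:R * (k%:R + 1)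
  / 2 :> R.
Proof.
elim: k => [|k IH]; first by rewrite big_geq// mul0r mul0r.
by rewrite big_nat_recr//= IH -(natr1 k); field.
Qed.

Theorem theorem6 (R : realType) (n : nat)
    (X : set 'rV[R]_n) (f : 'rV[R]_n -> R) (gradf : 'rV[R]_n -> 'rV[R]_n)
    (L l : R)
    (dXi : measure_display) (Xi : measurableType dXi) (mu : probability Xi R)
    (F : 'rV[R]_n -> Xi -> R) (G : 'rV[R]_n -> Xi -> 'rV[R]_n)
    (Lip : Xi -> R) (Lhat Lbar sigma : R)
    (dO : measure_display) (Omega : measurableType dO) (P : probability Omega R)
    (T N k : nat) (gamma : R) (x0 : 'rV[R]_n)
    (xi : nat -> nat -> Omega -> Xi) (x Gt : nat -> Omega -> 'rV[R]_n)
    (rk : Omega -> nat)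
    (X_nonempty : X !=set0) (X_convex : convex_set X) (X_compact : compact X)
    (f_C1 : C1_on X f gradf)
    (gradf_lipschitz : forall u v, X u -> X v ->
      enorm (gradf u - gradf v) <= L * enorm (u - v))
    (l_range : 0 <= l <= L)
    (f_lower_curvature : forall u v, X u -> X v ->
      - (l / 2) * enorm (u - v) ^+ 2 <= f u - f v - dotv (gradf v) (u - v))
    (sigma2_gt0 : 0 < sigma ^+ 2)
    (oracle : stochastic_oracle X f gradf mu F G Lip Lhat Lbar sigma)
    (L_le_Lbar : L <= Lbar)
    (T_gt0 : (0 < T)%N) (N_gt0 : (0 < N)%N) (T_le_k : (T <= k)%N)
    (gamma_ge : 4 * Lbar <= gamma) (gamma_gt0 : 0 < gamma)
    (x0_in_X : X x0)
    (xi_measurable : forall t i, (1 <= t <= k)%N ->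
      (i < nb_samples T N (small_batch T) t)%N ->
      measurable_fun [set: Omega] (xi t i))
    (xi_law : forall t i, (1 <= t <= k)%N ->
      (i < nb_samples T N (small_batch T) t)%N ->
      forall A : set Xi, measurable A -> P (xi t i @^-1` A) = mu A)
    (method : VR_SPG X G x0 T N k (small_batch T) (fun=> gamma) xi x Gt)
    (rk_measurable : measurable_fun [set: Omega] rk)
    (rk_lt_k : forall w, (rk w < k)%N)
    (rk_law : forall t, (1 <= t <= k)%N ->
      P [set w | rk w = t.-1] =
        (t%:R * (\sum_(1 <= j < k.+1) j%:R)^-1 : R)%:E)
    (independence : mutually_independent P
      (used_draws (nb_samples T N (small_batch T)) k) (draws xi rk)) :
  ('E_P [fun w => (enorm (g_X X gradf (fun=> gamma) x (rk w) w) ^+ 2)%R]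
     <= ((\sum_(1 <= t < k.+1) (t%:R / (8 * gamma)))^-1
         * (l * k%:R / 2 * diameter X ^+ 2
            + 3 * gamma / 2 * diameter X ^+ 2
            + 21 * (k%:R + 1) * k%:R * sigma ^+ 2 / (8 * gamma * N%:R)))%R%:E)%E
  /\
  (gamma = 4 * Lbar ->
   ('E_P [fun w => (enorm (g_X X gradf (fun=> gamma) x (rk w) w) ^+ 2)%R]
     <= (32 * Lbar * l * diameter X ^+ 2 / (k%:R + 1)
         + 384 * Lbar ^+ 2 * diameter X ^+ 2 / (k%:R * (k%:R + 1))
         + 42 * sigma ^+ 2 / N%:R)%R%:E)%E).

Proof.
case/andP: l_range => l_ge0 l_le_L; have L_ge0 := le_trans l_ge0 l_le_L.
have Lbar_ge0 := le_trans L_ge0 L_le_Lbar.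
have bound := output_gradient_bound X_nonempty X_convex X_compact
  gradf_lipschitz
  L_ge0 oracle T_gt0 N_gt0 gamma_gt0 x0_in_X xi_measurable xi_law method
  rk_measurable independence f_C1 T_le_k l_ge0 f_lower_curvature Lbar_ge0
  gamma_ge rk_lt_k rk_law.
split=> // gammaE; apply: (le_trans bound); rewrite lee_fin le_eqVlt.
apply/orP; left; apply/eqP.
have k0 : 0 < k%:R :> R by rewrite ltr0n (leq_trans T_gt0).
have N0 : 0 < N%:R :> R by rewrite ltr0n.
have Lbar0 : 0 < Lbar by move: gamma_gt0; rewrite gammaE; lra.
rewrite -mulr_suml sum_natr gammaE.
field; rewrite !gt_eqF//; lra.
Qed.
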